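(* Suppose $\mathcal D$ is equipped with an associative and commutative product $[\cdot,\cdot]$, and let $\varphi:\mathbb{K}(\mathbb{T}^{\mathcal D}_{\mathbf{H}_{CK}})\to\mathbb{K}(\mathcal D)$ be a $\mathbb{K}$-linear map. There exists a unique Hopf algebra morphism $\Phi:\mathbf{H}^{\mathcal D}_{CK}\to\mathbf{Csh}^{\mathcal D}$ such that $\pi\circ\Phi\circ i=\varphi$.
   Context: $\mathbb{K}$ is a field of characteristic zero, $\mathcal D$ a nonempty set. $\mathbf{H}^{\mathcal D}_{CK}$ is the Connes–Kreimer Hopf algebra of rooted forests (up to isomorphism) with vertices decorated by $\mathcal D$ (product the disjoint union; coproduct $\sum_{\boldsymbol v}Lea_{\boldsymbol v}(F)\otimes Roo_{\boldsymbol v}(F)$ over admissible cuts, i.e. sets of vertices pairwise not joined by an oriented path towards the root, $Lea$ being the subforest on vertices above the cut and $Roo$ on the others). $\mathbb{T}^{\mathcal D}_{\mathbf{H}_{CK}}$ is the set of nonempty decorated trees and $i$ the inclusion of their span. $\mathbf{Csh}^{\mathcal D}$ is the quasi-shuffle Hopf algebra: basis the words over $\mathcal D$, coproduct the deconcatenation, product $(v_1\dots v_k)\,\star\,(v_{k+1}\dots v_{k+l})=\sum_{r\ge0}\sum_{\zeta}w_1\dots w_{k+l-r}$ over surjections $\zeta:\{1,\dots,k+l\}\to\{1,\dots,k+l-r\}$ increasing on $\{1,\dots,k\}$ and on $\{k+1,\dots,k+l\}$, where $w_j=v_i$ if $\zeta^{-1}(j)=\{i\}$ and $w_j=[v_{i_1}v_{i_2}]$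 if $\zeta^{-1}(j)=\{i_1,i_2\}$. $\pi$ is the projection onto words of length one, identified with $\mathbb{K}(\mathcal D)$. *)

(* Defs.v *)
From HB Require Import structures.
From mathcomp Require Import all_boot all_algebra.
From mathcomp Require Import finmap.
From mathcomp Require Import monalg.

Set Implicit Arguments.
Unset Strict Implicit.
Unset Printing Implicit Defensive.

Import GRing.Theory.
Local Open Scope ring_scope.
Local Open Scope quotient_scope.

(* Planar representatives of rooted trees; a planar forest is a [seq] of     *)
(* them. Isomorphism classes are obtained by a quotient below.               *)

Inductive ptree (D : Type) : Type := Node of D & seq (ptree D).

Section PTreeInd.
Variables (D : Type) (P : ptree D -> Prop).
Hypothesis PNode : forall d F, foldr (fun t Q => P t /\ Q) True F -> P (Node d F).

Fixpoint ptree_nested_ind (t : ptree D) : P t :=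
  let: Node d F := t in
  PNode d ((fix all_P F : foldr (fun t Q => P t /\ Q) True F :=
    if F is t :: F' then conj (ptree_nested_ind t) (all_P F') else I) F).
End PTreeInd.

Section PTreeChoice.
Variable D : Type.

Fixpoint ptree_encode (t : ptree D) : GenTree.tree D :=
  let: Node d F := t in GenTree.Node 0 (GenTree.Leaf d :: map ptree_encode F).

Fixpoint ptree_decode (u : GenTree.tree D) : option (ptree D) :=
  if u is GenTree.Node _ (GenTree.Leaf d :: us) then
    Some (Node d (pmap ptree_decode us))
  else None.

Lemma ptree_encodeK : pcancel ptree_encode ptree_decode.
Proof.
elim/ptree_nested_ind=> d F IH /=; congr (Some (Node _ _)).
by elim: F IH => //= t F IHF [-> /IHF ->].
Qed.
End PTreeChoice.

HB.instance Definition _ (D : eqType) :=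
  Equality.copy (ptree D) (pcan_type (@ptree_encodeK D)).
HB.instance Definition _ (D : choiceType) :=
  Choice.copy (ptree D) (pcan_type (@ptree_encodeK D)).

(* Isomorphism of decorated rooted trees and forests: the trees of the two   *)
(* forests (the children of the two roots) are matched bijectively, into     *)
(* isomorphic pairs.                                                         *)

Fixpoint tree_iso (D : eqType) (t u : ptree D) {struct t} : bool :=
  match t, u with
  | Node d F, Node e G =>
      (d == e) && has (fun G' => all2 (@tree_iso D) F G') (permutations G)
  end.

Definition forest_iso (D : eqType) (F G : seq (ptree D)) : bool :=
  has (fun G' => all2 (@tree_iso D) F G') (permutations G).

Section IsoEquiv.
Variable D : eqType.
Implicit Types (t u v : ptree D) (F G H : seq (ptree D)).

Lemma tree_isoE d e F G :
  tree_iso (Node d F) (Node e G) = (d == e) && forest_iso F G.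
Proof. by []. Qed.

Lemma forest_isoP F G :
  reflect (exists2 G', perm_eq G' G & all2 (@tree_iso D) F G') (forest_iso F G).
Proof.
by apply: (iffP hasP) => -[G' G'P isoG']; exists G' => //;
   rewrite ?mem_permutations // -mem_permutations.
Qed.

Lemma all2_perm (T U : eqType) (r : T -> U -> bool) s s' q :
  all2 r s q -> perm_eq s' s -> exists2 q', perm_eq q' q & all2 r s' q'.
Proof.
case: s => [|x0 s0]; first by case: q => // _ /perm_nilP->; exists [::].
case: q => // y0 q0; move: (x0 :: s0) (y0 :: q0) => s q.
rewrite all2E => /andP[/eqP szq rsq] /(perm_iotaP x0)[Is pIs ->].
exists [seq nth y0 q i | i <- Is].
  by rewrite szq in pIs; apply/(perm_iotaP y0); exists Is.
rewrite all2E !size_map eqxx zip_map.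
rewrite (eq_map (g := nth (x0, y0) (zip s q))) => [|i]; last by rewrite nth_zip.
have pz : perm_eq [seq nth (x0, y0) (zip s q) i | i <- Is] (zip s q).
  by apply/(perm_iotaP (x0, y0)); exists Is; rewrite // size_zip -szq minnn.
by rewrite (perm_all _ pz).
Qed.

Lemma all2C (T U : Type) (r : T -> U -> bool) s q :
  all2 r s q = all2 (fun y x => r x y) q s.
Proof. by elim: s q => [|x s IH] [|y q] //=; rewrite IH. Qed.

Lemma tree_iso_refl t : tree_iso t t.
Proof.
elim/ptree_nested_ind: t => d F IH; rewrite tree_isoE eqxx.
apply/forest_isoP; exists F => //.
by elim: F IH => //= t F IHF [-> /IHF].
Qed.

Lemma tree_iso_sym_imp t u : tree_iso t u -> tree_iso u t.
Proof.
elim/ptree_nested_ind: t u => d F IH [e G].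
rewrite !tree_isoE eq_sym => /andP[-> /forest_isoP[G' pG isoG]] /=.
have : all2 (@tree_iso D) G' F.
  by elim: F G' IH isoG {pG} => [|t F IHF] [|u G'] //= [sym_t /IHF sym_F]
    /andP[/sym_t -> /sym_F].
rewrite perm_sym in pG.
by move=> /all2_perm/(_ pG)[F' pF isoF]; apply/forest_isoP; exists F'.
Qed.

Lemma tree_iso_trans t u v : tree_iso t u -> tree_iso u v -> tree_iso t v.
Proof.
elim/ptree_nested_ind: t u v => d F IH [e G] [f H].
rewrite !tree_isoE => /andP[/eqP-> /forest_isoP[G' pG isoG]].
move=> /andP[/eqP-> /forest_isoP[H' pH isoH]].
rewrite eqxx; have [H'' pH'' isoH''] := all2_perm isoH pG.
apply/forest_isoP; exists H''; first exact: perm_trans pH.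
elim: F G' H'' IH isoG isoH'' {pG pH''} => [|t F IHF] [|u G'] [|v H''] //=.
by move=> [trt /IHF trF] /andP[/trt isot /trF isoF] /andP[/isot -> /isoF].
Qed.

Lemma forest_iso_refl : reflexive (@forest_iso D).
Proof.
by move=> F; apply/forest_isoP; exists F => //; elim: F => //= t F ->;
   rewrite tree_iso_refl.
Qed.

Lemma tree_iso_sym : symmetric (@tree_iso D).
Proof. by move=> t u; apply/idP/idP; apply: tree_iso_sym_imp. Qed.

Lemma forest_iso_sym : symmetric (@forest_iso D).
Proof.
suff sym F G : forest_iso F G -> forest_iso G F.
  by move=> F G; apply/idP/idP; apply: sym.
move=> /forest_isoP[G' pG isoG]; rewrite perm_sym in pG.
have : all2 (@tree_iso D) G' F.
  by rewrite all2C; elim: F G' isoG {pG} => [|t F IH] [|u G'] //=;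
     rewrite tree_iso_sym => /andP[-> /IH].
by move=> /all2_perm/(_ pG)[F' pF isoF]; apply/forest_isoP; exists F'.
Qed.

Lemma forest_iso_trans : transitive (@forest_iso D).
Proof.
move=> G F H /forest_isoP[G' pG isoG] /forest_isoP[H' pH isoH].
have [H'' pH'' isoH''] := all2_perm isoH pG.
apply/forest_isoP; exists H''; first exact: perm_trans pH.
elim: F G' H'' isoG isoH'' {pG pH''} => [|t F IHF] [|u G'] [|v H''] //=.
by move=> /andP[tu FG] /andP[uv GH]; rewrite (tree_iso_trans tu uv) (IHF G').
Qed.

Lemma tree_iso_tr : transitive (@tree_iso D).
Proof. by move=> u t v; apply: tree_iso_trans. Qed.

Lemma forest_iso_cat F F' G G' :
  forest_iso F F' -> forest_iso G G' -> forest_iso (F ++ G) (F' ++ G').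
Proof.
move=> /forest_isoP[F1 pF isoF] /forest_isoP[G1 pG isoG].
apply/forest_isoP; exists (F1 ++ G1); first exact: perm_cat.
by elim: F F1 isoF {pF} => [|t F IH] [|u F1] //= /andP[-> /IH].
Qed.

Lemma forest_iso_catC F G : forest_iso (F ++ G) (G ++ F).
Proof.
have /forest_isoP[H pH isoH] := forest_iso_refl (F ++ G).
by apply/forest_isoP; exists H; rewrite // (perm_trans pH) // perm_catC.
Qed.

Lemma forest_iso_nil F : forest_iso F [::] -> F = [::].
Proof. by case/forest_isoP => G /perm_nilP->; case: F. Qed.

End IsoEquiv.

Section Classes.
Variable D : choiceType.

Definition tree_iso_equiv : equiv_rel (ptree D) :=
  EquivRel (@tree_iso D) (@tree_iso_refl D) (@tree_iso_sym D) (@tree_iso_tr D).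

Definition forest_iso_equiv : equiv_rel (seq (ptree D)) :=
  EquivRel (@forest_iso D)
    (@forest_iso_refl D) (@forest_iso_sym D) (@forest_iso_trans D).

Definition tree := {eq_quot tree_iso_equiv}.
Definition forest := {eq_quot forest_iso_equiv}.
HB.instance Definition _ := Choice.on tree.
HB.instance Definition _ := Quotient.on tree.
HB.instance Definition _ := EqQuotient.on tree.
HB.instance Definition _ := Choice.on forest.
HB.instance Definition _ := Quotient.on forest.
HB.instance Definition _ := EqQuotient.on forest.

Definition forest_of_tree (t : tree) : forest := \pi_forest [:: repr t].

Definition forest_unit : forest := \pi_forest [::].
Definition forest_union (x y : forest) : forest :=
  \pi_forest (repr x ++ repr y).

Lemma forest_piP F G : reflect (\pi_forest F = \pi_forest G) (forest_iso F G).
Proof. exact: (eqmodP forest_iso_equiv F G). Qed.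

Lemma forest_reprP F : forest_iso (repr (\pi_forest F)) F.
Proof. by apply/forest_piP; rewrite reprK. Qed.

Lemma forest_union_pi F G :
  forest_union (\pi_forest F) (\pi_forest G) = \pi_forest (F ++ G).
Proof. by apply/forest_piP/forest_iso_cat; apply: forest_reprP. Qed.

Lemma forest_unionA : associative forest_union.
Proof.
move=> x y z; apply/forest_piP.
have isoA := forest_iso_cat (forest_iso_refl (repr x))
                            (forest_reprP (repr y ++ repr z)).
apply: forest_iso_trans isoA _; rewrite catA forest_iso_sym.
exact: forest_iso_cat (forest_reprP _) (forest_iso_refl _).
Qed.

Lemma forest_unionC : commutative forest_union.
Proof. by move=> x y; apply/forest_piP/forest_iso_catC. Qed.

Lemma forest_union1x : left_id forest_unit forest_union.
Proof.
move=> x; rewrite -[RHS]reprK; apply/forest_piP.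
exact: forest_iso_cat (forest_reprP [::]) (forest_iso_refl _).
Qed.

Lemma forest_unionx1 : right_id forest_unit forest_union.
Proof. by move=> x; rewrite forest_unionC forest_union1x. Qed.

Lemma forest_union_unit x y :
  forest_union x y = forest_unit -> x = forest_unit /\ y = forest_unit.
Proof.
move=> /forest_piP/forest_iso_nil xy0; rewrite -[x]reprK -[y]reprK.
by move: xy0; case: (repr x) => [|//]; case: (repr y).
Qed.

HB.instance Definition _ := Choice_isMonomialDef.Build forest
  forest_unionA forest_union1x forest_unionx1 forest_union_unit.
HB.instance Definition _ := MonomialDef_isConomialDef.Build forest forest_unionC.

End Classes.

(* Vertices and subforests. A vertex of a planar forest is named by the path *)
(* leading to it: [:: i] is the root of the i-th tree, and i :: p lies in    *)
(* the i-th tree, at position p below. Hence there is an oriented path,      *)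
(* towards the roots, from w to v iff v is a prefix of w.                    *)

Definition imapcat (A B : Type) (f : nat -> A -> seq B) :=
  fix loop (i : nat) (s : seq A) : seq B :=
    if s is x :: s' then f i x ++ loop i.+1 s' else [::].

Section Vertices.
Variable D : choiceType.

Fixpoint tree_vertices (t : ptree D) : seq (seq nat) :=
  let: Node _ F := t in
  [::] :: imapcat (fun i u => map (cons i) (tree_vertices u)) 0 F.

Definition vertices (F : seq (ptree D)) : {fset seq nat} :=
  [fset v in imapcat (fun i u => map (cons i) (tree_vertices u)) 0 F]%fset.

(* The subforest on the vertices satisfying S: the descendants of a deleted   *)
(* vertex are attached to its closest remaining ancestor. No such contraction *)
(* of edges takes place in Lea and Roo below, as the set of vertices kept is  *)
(* stable by descendants, resp. by ancestors.                                 *)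
Fixpoint tree_restrict (t : ptree D) (S : pred (seq nat)) : seq (ptree D) :=
  let: Node d F := t in
  let F' := imapcat (fun i u => tree_restrict u (fun p => S (i :: p))) 0 F in
  if S [::] then [:: Node d F'] else F'.

Definition restrict (F : seq (ptree D)) (S : pred (seq nat)) : seq (ptree D) :=
  imapcat (fun i u => tree_restrict u (fun p => S (i :: p))) 0 F.

(* No two distinct vertices of c are joined by an oriented path. *)
Definition admissible (c : {fset seq nat}) : bool :=
  all2rel (fun v w => prefix v w ==> (v == w)) c.

(* The vertices of c count among the vertices above c. *)
Definition above (c : {fset seq nat}) : pred (seq nat) :=
  fun w => has (fun v => prefix v w) c.

Definition Lea (c : {fset seq nat}) (F : seq (ptree D)) := restrict F (above c).
Definition Roo (c : {fset seq nat}) (F : seq (ptree D)) :=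
  restrict F (predC (above c)).

End Vertices.

(* {malg K[B]} is the vector space with basis B, << b >> being the basis     *)
(* vector b and x@_b a coordinate of x. The tensor product of {malg K[A]}    *)
(* and {malg K[B]} is represented by [tensor K A B], the vector space with   *)
(* basis A * B, the pair (a, b) standing for a (x) b.                        *)

Notation tensor K A B := {malg K[(A * B)%type]}.

Section FreeModules.
Variable K : fieldType.

Definition linext (B : choiceType) (V : lmodType K) (f : B -> V)
  (x : {malg K[B]}) : V := \sum_(b <- msupp x) x@_b *: f b.

Definition tens (A B : choiceType) (x : {malg K[A]}) (y : {malg K[B]}) :
    tensor K A B :=
  linext (fun a => linext (fun b => << (a, b) >>) y) x.

Definition tens_map (A A' B B' : choiceType)
    (f : {malg K[A]} -> {malg K[A']}) (g : {malg K[B]} -> {malg K[B']}) :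
    tensor K A B -> tensor K A' B' :=
  linext (fun ab => tens (f << ab.1 >>) (g << ab.2 >>)).

End FreeModules.

(* The algebra structure of [HCK] is the monoid algebra structure provided   *)
(* by malg; its unit is the empty forest.                                    *)

Section ConnesKreimer.
Variables (K : fieldType) (D : choiceType).

Definition HCK := {malg K[forest D]}.
HB.instance Definition _ := GRing.ComAlgebra.on HCK.

Definition HCK_cop_forest (x : forest D) : tensor K (forest D) (forest D) :=
  let F := repr x in
  \sum_(c <- fpowerset (vertices F) | admissible c)
     << (\pi_(forest D) (Lea c F), \pi_(forest D) (Roo c F)) >>.

Definition HCK_cop : HCK -> tensor K (forest D) (forest D) :=
  linext HCK_cop_forest.

Definition HCK_counit (x : HCK) : K := x@_(forest_unit D).

Definition HCK_incl : {malg K[tree D]} -> HCK :=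
  linext (fun t => << forest_of_tree t >>).

End ConnesKreimer.

Section QuasiShuffle.
Variables (K : fieldType) (D : choiceType) (op : D -> D -> D).

Definition Csh := {malg K[seq D]}.
HB.instance Definition _ := GRing.Lmodule.on Csh.

Definition qsh_map k l n (z : {ffun 'I_(k + l) -> 'I_n}) : bool :=
  [&& [forall j, exists i, z i == j],
      [forall i : 'I_k, forall j : 'I_k,
         (i < j)%N ==> (z (lshift l i) < z (lshift l j))%N] &
      [forall i : 'I_l, forall j : 'I_l,
         (i < j)%N ==> (z (rshift k i) < z (rshift k j))%N]].

(* When z satisfies qsh_map, its fibres have one or two elements: the last   *)
(* case of the match does not occur, and the word has length n.              *)
Definition qsh_word k l n (v : (k + l).-tuple D)
    (z : {ffun 'I_(k + l) -> 'I_n}) : seq D :=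
  pmap (fun j => match [seq i <- enum 'I_(k + l) | z i == j] with
                 | [:: i] => Some (tnth v i)
                 | [:: i1; i2] => Some (op (tnth v i1) (tnth v i2))
                 | _ => None
                 end) (enum 'I_n).

Definition qsh_prod_word (u v : seq D) : Csh :=
  let k := size u in let l := size v in
  \sum_(r < (k + l).+1)
    \sum_(z : {ffun 'I_(k + l) -> 'I_(k + l - r)} | qsh_map z)
      << qsh_word (cat_tuple (in_tuple u) (in_tuple v)) z >>.

Definition qsh_prod (x y : Csh) : Csh :=
  linext (fun u => linext (fun v => qsh_prod_word u v) y) x.

Definition Csh_unit : Csh := << [::] >>.

Definition Csh_cop : Csh -> tensor K (seq D) (seq D) :=
  linext (fun w => \sum_(i < (size w).+1) << (take i w, drop i w) >>).

Definition Csh_counit (x : Csh) : K := x@_[::].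

Definition Csh_proj : Csh -> {malg K[D]} :=
  linext (fun w => if w is [:: d] then << d >> else 0).

(* A Hopf algebra morphism is a bialgebra morphism between Hopf algebras;    *)
(* compatibility with the antipodes is then automatic.                       *)
Definition hopf_morphism (Phi : {linear HCK K D -> Csh}) : Prop :=
  [/\ Phi 1 = Csh_unit,
      (forall x y, Phi (x * y) = qsh_prod (Phi x) (Phi y)),
      (forall x, Csh_counit (Phi x) = HCK_counit x) &
      (forall x, Csh_cop (Phi x) = tens_map Phi Phi (HCK_cop x))].

End QuasiShuffle.

(* Main.v *)
Require Import Defs.
From HB Require Import structures.
From mathcomp Require Import all_boot all_algebra.
From mathcomp Require Import finmap.
From mathcomp Require Import monalg.

Set Implicit Arguments.
Unset Strict Implicit.
Unset Printing Implicit Defensive.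

Import GRing.Theory.
Local Open Scope ring_scope.

(* [Csh] is cofree among connected coalgebras: a coalgebra morphism [Phi] is
   determined by [f = pi o Phi] through
     Phi x = eps x + sum f(x') . Phi(x''),
   where [.] prepends a letter to a word. A quasi-shuffle [u * v] contains a
   word of length one only if one factor is empty and the other is a letter, or
   if [u = a] and [v = b] are letters, which contributes [op a b]. So
   multiplicativity forces f(t1 ... tn) = [phi(t1) ... phi(tn)] for n > 0, which
   gives uniqueness. Conversely, with this [f] the displayed formula defines
   [Phi] by recursion on the number of vertices: it is comultiplicative because
   cuts are coassociative, and multiplicative by comparing first letters in
     au * bv = a(u * bv) + b(au * v) + op(a,b)(u * v).
   Cuts have a direct recursive description on planar forests, and sums over
   them of isomorphism-invariant terms depend only on isomorphism classes. *)

(** * Linear and bilinear extension *)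

Section LinearExtension.
Variable K : fieldType.

Section Linext.
Variables (B : choiceType) (V : lmodType K) (f : B -> V).

(** Coefficients vanish outside the support, so any larger finite index set gives the same sum.
    Several vectors can then share one index set, as the proof of linearity requires. *)
Lemma linextEw (d : {fset B}) (x : {malg K[B]}) :
  (msupp x `<=` d)%fset -> linext f x = \sum_(b <- d) x@_b *: f b.
Proof.
move=> xd; rewrite /linext (big_fset_incl _ xd) // => b _ /mcoeff_outdom ->.
by rewrite scale0r.
Qed.

Lemma linextU b : linext f << b >> = f b.
Proof.
by rewrite (linextEw msuppU_le) big_seq_fset1 mcoeffUU scale1r.
Qed.

Lemma linext_is_linear : linear (linext f).
Proof.
move=> a x y; pose d := (msupp x `|` msupp y)%fset.
have xd : (msupp x `<=` d)%fset by apply: fsubsetUl.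
have yd : (msupp y `<=` d)%fset by apply: fsubsetUr.
have xyd : (msupp (a *: x + y) `<=` d)%fset.
  apply: fsubset_trans (msuppD_le _ _) _; rewrite fsetSU //.
  exact: msuppZ_le.
rewrite (linextEw xd) (linextEw yd) (linextEw xyd).
rewrite scaler_sumr -big_split /=.
by apply: eq_bigr => b _; rewrite mcoeffD mcoeffZ scalerDl scalerA.
Qed.

HB.instance Definition _ :=
  GRing.isLinear.Build K {malg K[B]} V *:%R (linext f) linext_is_linear.

End Linext.

Lemma malg_sumE (B : choiceType) (x : {malg K[B]}) :
  x = linext (fun b => << b >>) x.
Proof.
rewrite /linext {1}[x]monalgE; apply: eq_bigr => b _.
by apply/malgP => c; rewrite mcoeffZ !mcoeffU mulr_natr.
Qed.

Lemma linext_uniq (B : choiceType) (V : lmodType K) (f : {malg K[B]} -> V) :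
  linear f -> f =1 linext (fun b => f << b >>).
Proof.
move=> lf x; pose g := HB.pack_for {linear {malg K[B]} -> V} f
  (GRing.isLinear.Build K {malg K[B]} V *:%R f lf).
rewrite {1}[x]malg_sumE -[f]/(g : _ -> _) linear_sum /=.
by apply: eq_bigr => b _; rewrite -[f]/(g : _ -> _) linearZ.
Qed.

(** Multilinear identities are reduced to basis vectors through this principle, one variable at a
    time. Linearity is taken as a plain predicate so that any expression in the variable can be
    treated. *)
Lemma eq_linear (B : choiceType) (V : lmodType K) (f g : {malg K[B]} -> V) :
  linear f -> linear g -> (forall b, f << b >> = g << b >>) -> f =1 g.
Proof.
move=> /linext_uniq lf /linext_uniq lg fg x; rewrite lf lg.
by apply: eq_bigr => b _; rewrite fg.
Qed.

Section Bilext.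
Variables (A B : choiceType) (V : lmodType K) (g : A -> B -> V).

(** [tens] and [qsh_prod] are convertible to instances of this extension, so its bilinearity serves
    both. *)
Definition bilext (x : {malg K[A]}) (y : {malg K[B]}) : V :=
  linext (fun a => linext (g a) y) x.

Lemma bilextUU a b : bilext << a >> << b >> = g a b.
Proof. by rewrite /bilext !linextU. Qed.

Lemma bilext_linear_r x : linear (bilext x).
Proof.
move=> a y z; rewrite /bilext /linext scaler_sumr -big_split /=.
apply: eq_bigr => b _.
by rewrite [\sum_(_ <- _) _](linext_is_linear (g b) a y z) scalerDr !scalerA
  mulrC.
Qed.

HB.instance Definition _ x :=
  GRing.isLinear.Build K {malg K[B]} V *:%R (bilext x) (bilext_linear_r x).

Lemma bilext_suml (I : Type) (r : seq I) (P : pred I) F y :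
  bilext (\sum_(i <- r | P i) F i) y = \sum_(i <- r | P i) bilext (F i) y.
Proof. exact: linear_sum. Qed.

Lemma bilext_sumr (I : Type) (r : seq I) (P : pred I) F x :
  bilext x (\sum_(i <- r | P i) F i) = \sum_(i <- r | P i) bilext x (F i).
Proof. exact: linear_sum. Qed.

Lemma bilext0l y : bilext 0 y = 0. Proof. exact: linear0. Qed.
Lemma bilext0r x : bilext x 0 = 0. Proof. exact: linear0. Qed.

Lemma bilextDl x x' y : bilext (x + x') y = bilext x y + bilext x' y.
Proof. exact: linearD. Qed.

Lemma bilextDr x y y' : bilext x (y + y') = bilext x y + bilext x y'.
Proof. exact: linearD. Qed.

Lemma bilextZl a x y : bilext (a *: x) y = a *: bilext x y.
Proof. exact: linearZ. Qed.

Lemma bilextZr a x y : bilext x (a *: y) = a *: bilext x y.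
Proof. exact: linearZ. Qed.

End Bilext.

Lemma tensE (A B : choiceType) (x : {malg K[A]}) (y : {malg K[B]}) :
  tens x y = bilext (fun a b => << (a, b) >>) x y.
Proof. by []. Qed.

Section TensorProduct.
Variables (A B : choiceType).
Implicit Types (x : {malg K[A]}) (y : {malg K[B]}).

Lemma tens0l y : tens (0 : {malg K[A]}) y = 0. Proof. exact: bilext0l. Qed.
Lemma tens0r x : tens x (0 : {malg K[B]}) = 0. Proof. exact: bilext0r. Qed.

Lemma tensDl x x' y : tens (x + x') y = tens x y + tens x' y.
Proof. exact: bilextDl. Qed.

Lemma tensDr x y y' : tens x (y + y') = tens x y + tens x y'.
Proof. exact: bilextDr. Qed.

Lemma tens_suml (I : Type) (r : seq I) (P : pred I) (E : I -> {malg K[A]}) y :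
  tens (\sum_(i <- r | P i) E i) y = \sum_(i <- r | P i) tens (E i) y.
Proof. exact: bilext_suml. Qed.

Lemma tens_sumr (I : Type) (r : seq I) (P : pred I) (E : I -> {malg K[B]}) x :
  tens x (\sum_(i <- r | P i) E i) = \sum_(i <- r | P i) tens x (E i).
Proof. exact: bilext_sumr. Qed.

End TensorProduct.

End LinearExtension.

(** * Recursive form of the quasi-shuffle product *)

Section QuasiShuffleRecursion.

(* A surjection [z] as in the definition of the product is encoded by its two *)
(* increasing lists of values, on the first and on the second word.           *)

Definition qsh_pos k l n (z : {ffun 'I_(k + l) -> 'I_n}) : seq nat * seq nat :=
  ([seq val (z (lshift l i)) | i <- enum 'I_k],
   [seq val (z (rshift k i)) | i <- enum 'I_l]).

Definition qsh_pair k l n (pq : seq nat * seq nat) : bool :=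
  [&& size pq.1 == k, size pq.2 == l, sorted ltn pq.1, sorted ltn pq.2,
      all (fun j => j < n)%N pq.1, all (fun j => j < n)%N pq.2 &
      all (fun j => (j \in pq.1) || (j \in pq.2)) (iota 0 n)].

(** The branches say who attains the value 0: the first letter of the first word, that of the second
    word, or both. Removing it and lowering the other values by one leaves a pair onto [n'] values.
    These are the three terms of the quasi-shuffle recursion. *)
Fixpoint qsh_enum n k l : seq (seq nat * seq nat) :=
  if n is n'.+1 then
    (if k is k'.+1 then
       [seq (0%N :: map succn pq.1, map succn pq.2) | pq <- qsh_enum n' k' l]
     else [::]) ++
    (if l is l'.+1 then
       [seq (map succn pq.1, 0%N :: map succn pq.2) | pq <- qsh_enum n' k l']
     else [::]) ++
    (if k is k'.+1 then if l is l'.+1 then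
       [seq (0%N :: map succn pq.1, 0%N :: map succn pq.2)
         | pq <- qsh_enum n' k' l']
     else [::] else [::])
  else if (k == 0%N) && (l == 0%N) then [:: ([::], [::])] else [::].

Lemma map_succn_all p : all (fun j => 0 < j)%N p -> exists q, p = map succn q.
Proof.
elim: p => [_|[|j] p IH] //=; first by exists [::].
by move=> /IH[q ->]; exists (j :: q).
Qed.

(** In a strictly increasing list 0 can only be the first entry; whether it is there decides the
    branch of [qsh_enum]. *)
Lemma sorted_ltn_succn p : sorted ltn p ->
  exists q, p = map succn q \/ p = 0%N :: map succn q.
Proof.
case: p => [_|[|j] p]; first by exists [::]; left.
  move=> /= /(order_path_min ltn_trans)/map_succn_all[q ->].
  by exists q; right.
move=> /= pj; have /map_succn_all[q ->] : all (fun i => 0 < i)%N p.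
  apply/allP => i ip; have /allP/(_ _ ip) := order_path_min ltn_trans pj.
  exact: leq_trans.
by exists (j :: q); left.
Qed.

Lemma sorted_map_succn p : sorted ltn (map succn p) = sorted ltn p.
Proof. by rewrite sorted_map. Qed.

Lemma path_map_succn p : path ltn 0 (map succn p) = sorted ltn p.
Proof.
by rewrite -sorted_map_succn; case: p.
Qed.

Lemma mem_map_succn0 p : (0%N \in map succn p) = false.
Proof. by apply/negP => /mapP[]. Qed.

Lemma mem_map_succnS j p : (j.+1 \in map succn p) = (j \in p).
Proof. by rewrite mem_map // => ? ? []. Qed.

Lemma all_succn n p :
  all (fun j => j < n.+1)%N (map succn p) = all (fun j => j < n)%N p.
Proof. by rewrite all_map. Qed.

Lemma mem_qsh_enum n k l pq : (pq \in qsh_enum n k l) = qsh_pair k l n pq.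
Proof.
(* [nseq b 0%N] is [[:: 0]] or [[::]]: the booleans [b] and [c] record which list starts with 0, and
   the value 0 is covered exactly when one of them does. *)
have cover p q m (b c : bool) : all (fun j =>
    (j \in nseq b 0%N ++ map succn p) || (j \in nseq c 0%N ++ map succn q))
      (iota 0 m.+1)
    = (b || c) && all (fun j => (j \in p) || (j \in q)) (iota 0 m).
  rewrite /= (iotaDl 1 0) all_map; congr (_ && _).
    by rewrite !mem_cat !mem_map_succn0 !orbF !mem_nseq !eqxx !andbT !lt0b.
  apply: eq_all => j /=.
  by rewrite !mem_cat !mem_nseq /= !andbF /= !mem_map_succnS.
have inL k' l' n' p q : qsh_pair k'.+1 l' n'.+1 (0%N :: map succn p,
  map succn q)
    = qsh_pair k' l' n' (p, q).
  have /= cv := cover p q n' true false; rewrite /qsh_pair /= eqSS !size_map.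
  by rewrite path_map_succn sorted_map_succn !all_succn cv.
have inR k' l' n' p q : qsh_pair k' l'.+1 n'.+1 (map succn p,
  0%N :: map succn q)
    = qsh_pair k' l' n' (p, q).
  have /= cv := cover p q n' false true; rewrite /qsh_pair /= eqSS !size_map.
  by rewrite path_map_succn sorted_map_succn !all_succn cv.
have inB k' l' n' p q :
    qsh_pair k'.+1 l'.+1 n'.+1 (0%N :: map succn p, 0%N :: map succn q)
    = qsh_pair k' l' n' (p, q).
  have /= cv := cover p q n' true true; rewrite /qsh_pair /= !eqSS !size_map.
  by rewrite !path_map_succn !all_succn cv.
elim: n k l pq => [|n IH] k l [p q].
  apply/idP/idP => [|].
    by rewrite /=; case: k l => [|k] [|l] //=; rewrite inE => /eqP[-> ->].
  move=> /and5P[/eqP <- /eqP <- _ _ /and3P[]].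
  by case: p => //; case: q => //=; rewrite inE.
apply/idP/idP => [|Hpq].
  rewrite /= !mem_cat => /or3P[].
  - case: k => // k /mapP[[p' q'] + [-> ->]] /=.
    by rewrite IH inL.
  - case: l => // l /mapP[[p' q'] + [-> ->]] /=.
    by rewrite IH inR.
  - case: k => // k; case: l => // l /mapP[[p' q'] + [-> ->]] /=.
    by rewrite IH inB.
have /and5P[/= /eqP kE /eqP lE sp sq _] := Hpq.
rewrite /= !mem_cat.
have [p' [pE|pE]] := sorted_ltn_succn sp;
  have [q' [qE|qE]] := sorted_ltn_succn sq; move: kE lE Hpq;
  rewrite {}pE {}qE => <- <-.
(* Neither list contains 0, against the covering condition. *)
- by move=> /and5P[_ _ _ _ /and3P[_ _ /=]]; rewrite !mem_map_succn0.
- rewrite inR -IH => Hpq; apply/or3P/Or32 => /=.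
  exact: (map_f (fun pq => (map succn pq.1, 0%N :: map succn pq.2)) Hpq).
- rewrite inL -IH => Hpq; apply/or3P/Or31 => /=.
  exact: (map_f (fun pq => (0%N :: map succn pq.1, map succn pq.2)) Hpq).
- rewrite inB -IH => Hpq; apply/or3P/Or33 => /=.
  exact: (map_f (fun pq => (0%N :: map succn pq.1, 0%N :: map succn pq.2)) Hpq).
Qed.

(** The branches are disjoint, as they differ in which lists start with 0, and each is the injective
    image of a duplicate-free list. *)
Lemma qsh_enum_uniq n k l : uniq (qsh_enum n k l).
Proof.
have Sinj : injective (map succn) by apply: inj_map => ? ? [].
elim: n k l => [|n IH] k l /=; first by case: ifP.
rewrite !cat_uniq has_cat negb_or; apply/and5P; split.
- by case: k => // k; rewrite map_inj_uniq // =>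
    -[p q] [p' q'] [/Sinj-> /Sinj->].
- apply/andP; split; apply/hasPn => -[p q].
    case: l => // l /mapP[[p1 q1] _ [_ ->]]; case: k => // k.
    by apply/negP => /mapP[[p2 q2] _ [_]]; case: q2.
  case: k => // k; case: l => // l /mapP[[p1 q1] _ [_ ->]].
  by apply/negP => /mapP[[p2 q2] _ [_]]; case: q2.
- by case: l => // l; rewrite map_inj_uniq // =>
    -[p q] [p' q'] [/Sinj-> /Sinj->].
- apply/hasPn => -[p q].
  case: k => // k; case: l => // l /mapP[[p1 q1] _ [-> _]].
  by apply/negP => /mapP[[p2 q2] _ []]; case: p2.
- case: k => // k; case: l => // l; rewrite map_inj_uniq //.
  by move=> -[p q] [p' q'] [/Sinj-> /Sinj->].
Qed.

Lemma enum_ordD k l :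
  enum 'I_(k + l) = map (@lshift k l) (enum 'I_k) ++ map (@rshift k l) (enum
    'I_l).
Proof.
apply: (inj_map val_inj); rewrite map_cat val_enum_ord iotaD.
rewrite -(map_comp _ (@lshift k l)) -(map_comp _ (@rshift k l)).
congr (_ ++ _); first by rewrite -[LHS]val_enum_ord; apply: eq_map.
by rewrite add0n -[k in LHS]addn0 iotaDl -val_enum_ord -map_comp; apply: eq_map.
Qed.

Lemma qsh_pos_inj k l n : injective (@qsh_pos k l n).
Proof.
move=> z z' [/eq_in_map el /eq_in_map er]; apply/ffunP => i.
case: (split_ordP i) => j ->; apply: val_inj.
  by apply: el; rewrite mem_enum.
by apply: er; rewrite mem_enum.
Qed.

Lemma sorted_map_enum k (f : 'I_k -> nat) :
  sorted ltn (map f (enum 'I_k))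
    = [forall i : 'I_k, forall j : 'I_k, (i < j)%N ==> (f i < f j)%N].
Proof.
rewrite sorted_map; apply/idP/'forall_forallP => [sf i j | Hf].
  apply/implyP => ij.
  have tr : transitive (relpre f ltn) by move=> y x z /=; apply: ltn_trans.
  have /(_ (val i) (val j)) := sorted_ltn_nth tr i sf.
  by rewrite !inE size_enum_ord !ltn_ord !nth_ord_enum; apply.
apply/(sub_sorted (e := relpre val ltn)) => [i j /= ij|].
  by have /implyP := Hf i j; apply.
by rewrite -sorted_map val_enum_ord iota_ltn_sorted.
Qed.

Lemma qsh_mapE k l n (z : {ffun 'I_(k + l) -> 'I_n}) :
  qsh_map z = qsh_pair k l n (qsh_pos z).
Proof.
rewrite /qsh_map /qsh_pair /= !size_map -!enumT !size_enum_ord !eqxx.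
rewrite -(sorted_map_enum (fun i => z (lshift l i))).
rewrite -(sorted_map_enum (fun i => z (rshift k i))) /=.
set a := sorted _ _; set b := sorted _ _.
have -> : all (fun j => j < n)%N [seq val (z (lshift l i)) | i <- enum 'I_k].
  by apply/allP => _ /mapP[i _ ->]; apply: ltn_ord.
have -> : all (fun j => j < n)%N [seq val (z (rshift k i)) | i <- enum 'I_l].
  by apply/allP => _ /mapP[i _ ->]; apply: ltn_ord.
rewrite /= andbC -andbA; congr [&& _, _ & _].
apply/forallP/allP => /= [Hz j|Hz j].
  rewrite mem_iota /= => jn; have /existsP[i /eqP] := Hz (Ordinal jn).
  move=> /(congr1 val) /= <-.
  case: (split_ordP i) => i' ->.
    by rewrite (map_f (fun i => val (z (lshift l i)))) ?mem_enum.
  by rewrite orbC (map_f (fun i => val (z (rshift k i)))) ?mem_enum.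
have /Hz/orP[] : val j \in iota 0 n by rewrite mem_iota /=.
  by case/mapP => i _ jE; apply/existsP; exists (lshift l i); apply/eqP/val_inj.
by case/mapP => i _ jE; apply/existsP; exists (rshift k i); apply/eqP/val_inj.
Qed.

Lemma qsh_pos_surj k l n pq :
  qsh_pair k l n pq -> exists z : {ffun 'I_(k + l) -> 'I_n}, qsh_pos z = pq.
Proof.
case: pq => p q /and5P[/= /eqP pk /eqP ql _ _ /and3P[pn qn _]].
have pi (i : 'I_k) : (nth 0%N p i < n)%N.
  by apply: (allP pn); rewrite mem_nth ?pk.
have qi (i : 'I_l) : (nth 0%N q i < n)%N.
  by apply: (allP qn); rewrite mem_nth ?ql.
(* Indices of the first word read their value in [p], those of the second word in [q]. *)
exists [ffun i => match split i with
                  | inl i => Ordinal (pi i)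
                  | inr i => Ordinal (qi i)
                  end].
congr (_, _).
  rewrite (eq_map (g := nth 0%N p \o val)) => [|i /=]; last first.
    by rewrite ffunE -[lshift l i]/(unsplit (inl i)) unsplitK.
  rewrite map_comp val_enum_ord -pk; exact: mkseq_nth.
rewrite (eq_map (g := nth 0%N q \o val)) => [|i /=]; last first.
  by rewrite ffunE -[rshift k i]/(unsplit (inr i)) unsplitK.
rewrite map_comp val_enum_ord -ql; exact: mkseq_nth.
Qed.

(** This turns the sum over surjections into a sum over a recursively defined list. *)
Lemma perm_qsh_pos k l n :
  perm_eq [seq qsh_pos z | z : {ffun 'I_(k + l) ->
    'I_n} in [pred z | qsh_map z]]
    (qsh_enum n k l).
Proof.
apply: uniq_perm; rewrite ?qsh_enum_uniq //.
  by rewrite map_inj_uniq ?enum_uniq //; apply: qsh_pos_inj.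
move=> pq; rewrite mem_qsh_enum; apply/mapP/idP => [[z] | pq_pair].
  by rewrite mem_enum inE qsh_mapE => ? ->.
have [z zE] := qsh_pos_surj pq_pair.
by exists z; rewrite // mem_enum inE qsh_mapE zE.
Qed.

End QuasiShuffleRecursion.

(** * Words attached to pairs of position lists, and the recursion on first letters *)

Section Words.
Variables (D : choiceType) (op : D -> D -> D).

Definition omerge (x y : option D) : option D :=
  match x, y with
  | Some a, Some b => Some (op a b)
  | Some a, None => Some a
  | None, _ => y
  end.

(* A position absent from [pq.1] has index [size pq.1 = size u] there, where  *)
(* [onth u] is [None]; likewise for [v].                                      *)
Definition qsh_letter u v (pq : seq nat * seq nat) (j : nat) : option D :=
  omerge (onth u (index j pq.1)) (onth v (index j pq.2)).

Definition qsh_pair_word n u v pq : seq D :=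
  pmap (qsh_letter u v pq) (iota 0 n).

(** Fibres of an injective function have at most one point. If [j] is not a value, [index] returns
    the length [k], which [insub] rejects. *)
Lemma filter_enum_index k (f : 'I_k -> nat) j : injective f ->
  [seq i <- enum 'I_k | f i == j]
    = oapp (fun i => [:: i]) [::] (insub (index j (map f (enum 'I_k)))).
Proof.
move=> f_inj; case: (boolP (j \in map f (enum 'I_k))) => [/mapP[i _ ->]|jNf].
  rewrite index_map // index_enum_ord valK /=.
  rewrite -[RHS](filter_pred1_uniq (enum_uniq 'I_k)) ?mem_enum //.
  by apply: eq_filter => i' /=; rewrite inj_eq.
rewrite memNindex // size_map size_enum_ord insubN ?ltnn //=.
apply/eqP; rewrite -(negbK (_ == _)) -has_filter; apply/hasPn => i _.
by apply: contraNneq jNf => <-; rewrite map_f ?mem_enum.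
Qed.

Lemma onth_insub (s : seq D) i :
  onth s i = omap (tnth (in_tuple s)) (insub i : option 'I_(size s)).
Proof.
case: insubP => [i' _ <- /=|]; last by rewrite -leqNgt => /onth_default->.
exact/(tnth_onth _ (in_tuple s)).
Qed.

Lemma sorted_map_enum_inj k (f : 'I_k -> nat) :
  sorted ltn (map f (enum 'I_k)) -> injective f.
Proof.
rewrite sorted_map_enum => /'forall_forallP/= Hf i j fij; apply: val_inj => /=.
have /implyP := Hf i j; have /implyP := Hf j i; rewrite fij ltnn.
by case: (ltngtP i j) => // _ H1 H2; [have := H2 isT | have := H1 isT].
Qed.

Lemma pmap_map (A B C : Type) (f : B -> option C) (g : A -> B) s :
  pmap f (map g s) = pmap (f \o g) s.
Proof. by elim: s => //= x s ->. Qed.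

Lemma qsh_wordE u v n (z : {ffun 'I_(size u + size v) -> 'I_n}) : qsh_map z ->
  qsh_word op (cat_tuple (in_tuple u) (in_tuple v)) z
    = qsh_pair_word n u v (qsh_pos z).
Proof.
rewrite qsh_mapE => /and5P[_ _ /= sl sr _].
rewrite /qsh_pair_word -val_enum_ord /qsh_word pmap_map.
(* The fibre over [j] splits into its parts in the two words; each part has at most one element
   because [z] is increasing on both blocks. *)
apply: eq_pmap => j; rewrite enum_ordD filter_cat.
rewrite (filter_map (@lshift _ _)) (filter_map (@rshift _ _)).
have el : preim (@lshift (size u) (size v)) (fun i => z i == j)
    =1 fun i => val (z (lshift (size v) i)) == val j by [].
have er : preim (@rshift (size u) (size v)) (fun i => z i == j)
    =1 fun i => val (z (rshift (size u) i)) == val j by [].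
rewrite (eq_filter el) (eq_filter er).
rewrite (@filter_enum_index _ (fun i => val (z (lshift (size v) i))));
  last exact: sorted_map_enum_inj.
rewrite (@filter_enum_index _ (fun i => val (z (rshift (size u) i))));
  last exact: sorted_map_enum_inj.
rewrite /qsh_letter /= !onth_insub.
by case: insubP => [i _ _|_]; case: insubP => [i' _ _|_] //=;
  rewrite ?tnth_lshift ?tnth_rshift.
Qed.

Variable K : fieldType.

Definition qsh_sum n u v : {malg K[seq D]} :=
  \sum_(pq <- qsh_enum n (size u) (size v)) << qsh_pair_word n u v pq >>.

Lemma sum_qsh_map n u v :
  \sum_(z : {ffun 'I_(size u + size v) -> 'I_n} | qsh_map z)
      << qsh_word op (cat_tuple (in_tuple u) (in_tuple v)) z >> = qsh_sum n u v.
Proof.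
rewrite /qsh_sum -(perm_big _ (perm_qsh_pos _ _ _)) big_image /=.
by apply: eq_bigr => z zP; rewrite qsh_wordE.
Qed.

(** A surjection from [k + l] points takes at most [k + l] values. *)
Lemma qsh_enum_default n k l : (k + l < n)%N -> qsh_enum n k l = [::].
Proof.
elim: n k l => // n IH [|k] [|l] //; rewrite ?addSn ?addnS ltnS => kln /=.
- by rewrite IH.
- by rewrite IH // addn0.
by rewrite !IH ?addSn ?addnS // ltnW.
Qed.

(** The product is indexed here by the number of values instead of the defect [r]. Every large
    enough [N] gives the same sum, which lets products of words of different lengths share a
    range. *)
Lemma qsh_prod_wordE N u v : (size u + size v < N)%N ->
  qsh_prod_word K op u v = \sum_(n < N) qsh_sum n u v.
Proof.
move=> uvN; rewrite -(big_mkord xpredT (fun n => qsh_sum n u v)).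
rewrite (big_cat_nat _ uvN) //= [X in _ + X]big1_seq ?addr0; last first.
  move=> n /andP[_]; rewrite mem_index_iota => /andP[uvn _].
  by rewrite /qsh_sum qsh_enum_default // big_nil.
(* [rev_ord] exchanges [r] with [k + l - r]. *)
rewrite big_mkord (reindex_inj rev_ord_inj) /=.
by apply: eq_bigr => r _; rewrite subSS -sum_qsh_map.
Qed.

Definition wcons (d : D) : {malg K[seq D]} -> {malg K[seq D]} :=
  linext (fun w => << d :: w >>).

Lemma wconsU d w : wcons d << w >> = << d :: w >>.
Proof. exact: linextU. Qed.

HB.instance Definition _ d := GRing.isLinear.Build K {malg K[seq D]}
  {malg K[seq D]} *:%R (wcons d) (linext_is_linear _).

Lemma qsh_sum0 d u v : qsh_sum 0 (d :: u) v = 0.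
Proof. by rewrite /qsh_sum /= big_nil. Qed.

Lemma qsh_pair_wordS n u v pq : qsh_pair_word n.+1 u v pq
  = if qsh_letter u v pq 0 is Some d
    then d :: pmap (qsh_letter u v pq \o succn) (iota 0 n)
    else pmap (qsh_letter u v pq \o succn) (iota 0 n).
Proof.
by rewrite /qsh_pair_word /= (iotaDl 1 0) pmap_map; case: qsh_letter.
Qed.

Lemma index_map_succn p j : index j.+1 (map succn p) = index j p.
Proof. by rewrite index_map // => ? ? []. Qed.

(** 0 is absent from a shifted list, so [index] returns its length, which is out of range for
    [u]. *)
Lemma onth_index_map_succn0 (u : seq D) p : size p = size u ->
  onth u (index 0%N (map succn p)) = None.
Proof.
by move=> pu; rewrite memNindex ?mem_map_succn0 // size_map pu onth_default.
Qed.

Lemma size_mem_qsh_enum n k l pq :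
  pq \in qsh_enum n k l -> size pq.1 = k /\ size pq.2 = l.
Proof. by rewrite mem_qsh_enum => /and5P[/eqP-> /eqP->]. Qed.

Lemma wcons_sum d n u v : wcons d (qsh_sum n u v)
  = \sum_(pq <- qsh_enum n (size u) (size v)) << d :: qsh_pair_word n u v pq >>.
Proof.
by rewrite /wcons /qsh_sum linear_sum /=; apply: eq_bigr => pq _;
  rewrite linextU.
Qed.

Lemma qsh_pair_word_consl n a u v p q : size q = size v ->
  qsh_pair_word n.+1 (a :: u) v (0%N :: map succn p, map succn q)
    = a :: qsh_pair_word n u v (p, q).
Proof.
move=> sq; rewrite qsh_pair_wordS /qsh_letter /= onth_index_map_succn0 //=.
by congr (_ :: _); apply: eq_pmap => j; rewrite /= !index_map_succn.
Qed.

Lemma qsh_pair_word_consr n b u v p q : size p = size u ->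
  qsh_pair_word n.+1 u (b :: v) (map succn p, 0%N :: map succn q)
    = b :: qsh_pair_word n u v (p, q).
Proof.
move=> sp; rewrite qsh_pair_wordS /qsh_letter /= onth_index_map_succn0 //=.
by congr (_ :: _); apply: eq_pmap => j; rewrite /= !index_map_succn.
Qed.

Lemma qsh_pair_word_cons n a u b v p q :
  qsh_pair_word n.+1 (a :: u) (b :: v) (0%N :: map succn p, 0%N :: map succn q)
    = op a b :: qsh_pair_word n u v (p, q).
Proof.
rewrite qsh_pair_wordS /qsh_letter /=.
by congr (_ :: _); apply: eq_pmap => j; rewrite /= !index_map_succn.
Qed.

(** There is one summand per branch of [qsh_enum]: the letter at position 0 is [a], [b] or
    [op a b]. *)
Lemma qsh_sumS n a u b v : qsh_sum n.+1 (a :: u) (b :: v)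
  = wcons a (qsh_sum n u (b :: v)) + wcons b (qsh_sum n (a :: u) v)
    + wcons (op a b) (qsh_sum n u v).
Proof.
rewrite !wcons_sum {1}/qsh_sum /= !big_cat /= !big_map addrA.
apply: f_equal2; [apply: f_equal2|].
all: apply: eq_big_seq => -[p q] /size_mem_qsh_enum[sp sq].
- by rewrite qsh_pair_word_consl.
- by rewrite qsh_pair_word_consr.
- by rewrite qsh_pair_word_cons.
Qed.

Lemma qsh_sumS_nil_l n b v : qsh_sum n.+1 [::] (b :: v)
  = wcons b (qsh_sum n [::] v).
Proof.
rewrite !wcons_sum {1}/qsh_sum /= cats0 !big_map /=.
apply: eq_big_seq => -[p q] /size_mem_qsh_enum[sp sq].
by rewrite qsh_pair_word_consr.
Qed.

Lemma qsh_sumS_nil_r n a u : qsh_sum n.+1 (a :: u) [::]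
  = wcons a (qsh_sum n u [::]).
Proof.
rewrite !wcons_sum {1}/qsh_sum /= cats0 !big_map /=.
apply: eq_big_seq => -[p q] /size_mem_qsh_enum[sp sq].
by rewrite qsh_pair_word_consl.
Qed.

Lemma qsh_prod_word_nil_l v : qsh_prod_word K op [::] v = << v >>.
Proof.
elim: v => [|b v IH].
  by rewrite (@qsh_prod_wordE 1) // big_ord1 /qsh_sum /= big_seq1.
rewrite (@qsh_prod_wordE (size v).+2) // big_ord_recl.
rewrite {1}/qsh_sum /= big_nil add0r.
under eq_bigr do rewrite qsh_sumS_nil_l.
by rewrite -linear_sum -qsh_prod_wordE // IH /= wconsU.
Qed.

Lemma qsh_prod_word_nil_r u : qsh_prod_word K op u [::] = << u >>.
Proof.
elim: u => [|a u IH]; first exact: qsh_prod_word_nil_l.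
rewrite (@qsh_prod_wordE (size u).+2) ?addn0 // big_ord_recl qsh_sum0 add0r.
under eq_bigr do rewrite qsh_sumS_nil_r.
by rewrite -linear_sum -qsh_prod_wordE ?addn0 // IH /= wconsU.
Qed.

Lemma qsh_prod_word_cons a u b v : qsh_prod_word K op (a :: u) (b :: v)
  = wcons a (qsh_prod_word K op u (b :: v))
    + wcons b (qsh_prod_word K op (a :: u) v)
    + wcons (op a b) (qsh_prod_word K op u v).
Proof.
(* The three products on the right share one bound. The product on the left takes one more, and its
   extra term, for [n = 0], vanishes. *)
have N1 : (size u + size (b :: v) < (size u + size v).+2)%N by rewrite addnS.
have N2 : (size (a :: u) + size v < (size u + size v).+2)%N by rewrite addSn.
have N3 : (size u + size v < (size u + size v).+2)%N by rewrite ltnW.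
rewrite (qsh_prod_wordE N1) (qsh_prod_wordE N2) (qsh_prod_wordE N3).
rewrite (@qsh_prod_wordE (size u + size v).+3) /= ?addSn ?addnS //.
rewrite big_ord_recl qsh_sum0 add0r !linear_sum -!big_split /=.
by apply: eq_bigr => n _; rewrite qsh_sumS.
Qed.

End Words.

(** * Cuts of planar forests *)

Section PowersetSums.
Variables (T : choiceType) (R : Type) (idx : R) (op : Monoid.com_law idx).
Implicit Types (A B : {fset T}).

(** A subset of a disjoint union is, in a unique way, a union of a subset of each part, recovered by
    intersecting with [A] and [B]. *)
Lemma big_fpowersetU A B (h : {fset T} -> R) : [disjoint A & B]%fset ->
  \big[op/idx]_(c <- fpowerset (A `|` B)%fset) h c
    = \big[op/idx]_(a <- fpowerset A) \big[op/idx]_(b <- fpowerset B)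
        h (a `|` b)%fset.
Proof.
move=> dAB; rewrite -(big_allpairs_dep (h := fun a b : {fset T} =>
  (a `|` b)%fset)).
apply: perm_big; apply: uniq_perm; rewrite ?fset_uniq //.
  apply: allpairs_uniq; rewrite ?fset_uniq //.
  move=> [a b] [a' b'] /allpairsP[[x y] [/= xA yB [-> ->]]].
  move=> /allpairsP[[x' y'] [/= x'A y'B [-> ->]]] E.
  move: xA yB x'A y'B E; rewrite !fpowersetE => xA yB x'A y'B E.
  have restrA c d : (c `<=` A -> d `<=` B -> (c `|` d) `&` A = c)%fset.
    move=> cA dB; rewrite fsetIUl (fsetIidPl cA).
    have /eqP-> : (d `&` A == fset0)%fset.
      by rewrite fsetI_eq0 fdisjoint_sym (fdisjointWr dB).
    by rewrite fsetU0.
  have restrB c d : (c `<=` A -> d `<=` B -> (c `|` d) `&` B = d)%fset.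
    move=> cA dB; rewrite fsetIUl (fsetIidPl dB).
    have /eqP-> : (c `&` B == fset0)%fset.
      by rewrite fsetI_eq0 (fdisjointWl cA).
    by rewrite fset0U.
  have -> : x = x' by rewrite -[LHS](restrA x y) //= [X in (X `&` _)%fset]E
    restrA.
  have -> // : y = y' by rewrite -[LHS](restrB x y) //= [X in (X `&` _)%fset]E
    restrB.
move=> c; rewrite fpowersetE; apply/idP/allpairsP => [cAB|[[a b]]].
  exists ((c `&` A)%fset, (c `&` B)%fset); split;
    rewrite ?fpowersetE ?fsubsetIr //=.
  by rewrite -fsetIUr (fsetIidPl cAB).
by rewrite !fpowersetE => -[/= aA bB ->]; apply: fsetUSS.
Qed.

Lemma big_fpowerset_imfset (U : choiceType) (f : T -> U) A
    (h : {fset U} -> R) : injective f ->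
  \big[op/idx]_(c <- fpowerset (f @` A)%fset) h c
    = \big[op/idx]_(a <- fpowerset A) h (f @` a)%fset.
Proof.
move=> f_inj; rewrite -(big_map (fun a : {fset T} => (f @` a)%fset) xpredT).
have F_inj : injective (fun a : {fset T} => (f @` a)%fset).
  move=> a b ab; apply/fsetP => x.
  have memF (c : {fset T}) : (f x \in f @` c)%fset
    = (x \in c) by rewrite mem_imfset.
  by rewrite -!memF ab.
apply: perm_big; apply: uniq_perm; rewrite ?map_inj_uniq ?fset_uniq //.
move=> c; rewrite fpowersetE; apply/idP/mapP => [cA|[a]]; last first.
  by rewrite fpowersetE => aA ->; apply: subset_imfset => x;
    apply: (fsubsetP aA).
exists [fset x in A | f x \in c]%fset; first by rewrite fpowersetE fset_sub.
apply/fsetP => y; apply/idP/imfsetP => [yc|[x]]; last first.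
  by rewrite !inE => /andP[_ xc] ->.
have /imfsetP[x /= xA yE] := fsubsetP cA _ yc.
by exists x; rewrite // !inE xA -yE.
Qed.

Lemma big_fpowerset1U x A (h : {fset T} -> R) : x \notin A ->
  \big[op/idx]_(c <- fpowerset (x |` A)%fset) h c
    = op (\big[op/idx]_(a <- fpowerset A) h (x |` a)%fset)
         (\big[op/idx]_(a <- fpowerset A) h a).
Proof.
move=> xA; rewrite big_fpowersetU ?fdisjoint1X // fpowerset1.
rewrite big_fsetU1 ?big_seq_fset1 /=; last first.
  by rewrite inE eq_sym -fsubset0 fsub1set.
rewrite Monoid.mulmC; apply: f_equal2 => //.
by apply: eq_bigr => a _; rewrite fset0U.
Qed.

End PowersetSums.

(** * Recursive enumeration of the admissible cuts *)

Section PlanarCuts.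
Variable D : choiceType.
Implicit Types (t : ptree D) (F G : seq (ptree D)) (c : {fset seq nat}).

(* The entries are the pairs (Lea, Roo) of the admissible cuts. *)
Definition fcuts_with (tc : ptree D -> seq (seq (ptree D) * seq (ptree D))) :=
  fix loop F := if F is t :: F' then
    [seq (a.1 ++ b.1, a.2 ++ b.2) | a <- tc t, b <- loop F'] else [:: ([::],
      [::])].

(** A cut containing the root is the root alone, with the whole tree above it. Any other cut is a
    cut of the forest of children, and the root stays in the [Roo] part. *)
Fixpoint tcuts t : seq (seq (ptree D) * seq (ptree D)) :=
  let: Node d F := t in
  ([:: Node d F], [::])
    :: [seq (a.1, [:: Node d a.2]) | a <- fcuts_with tcuts F].

Definition cuts F := fcuts_with tcuts F.

Lemma cuts_cons t F :
  cuts (t :: F) = [seq (a.1 ++ b.1, a.2 ++ b.2) | a <- tcuts t, b <- cuts F].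
Proof. by []. Qed.

Lemma tcutsE d F : tcuts (Node d F)
  = ([:: Node d F], [::]) :: [seq (a.1, [:: Node d a.2]) | a <- cuts F].
Proof. by []. Qed.

(** Numbering from [i] lets inductions pass to the tail of a forest, where paths keep their first
    entries; [vertices] is the case [i = 0]. *)
Definition vertices_from i F : {fset seq nat} :=
  [fset v in imapcat (fun i u => map (cons i) (tree_vertices u)) i F]%fset.

Definition restrict_from i F (S : pred (seq nat)) :=
  imapcat (fun i u => tree_restrict u (fun p => S (i :: p))) i F.

Definition tvertices t : {fset seq nat} := [fset v in tree_vertices t]%fset.

Lemma in_vertices_from i F v : (v \in vertices_from i F)
  = (v \in imapcat (fun i u => map (cons i) (tree_vertices u)) i F).
Proof. by rewrite !inE. Qed.

Lemma in_tvertices t v : (v \in tvertices t) = (v \in tree_vertices t).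
Proof. by rewrite !inE. Qed.

Lemma vertices_from_cons i t F :
  vertices_from i (t :: F) = ((cons i @` tvertices t) `|` vertices_from i.+1
    F)%fset.
Proof.
apply/fsetP => v; rewrite inE !in_vertices_from mem_cat; congr (_ || _).
by apply/mapP/imfsetP => -[p + ->]; exists p;
  rewrite ?in_tvertices // -in_tvertices.
Qed.

Lemma tverticesE d F : tvertices (Node d F) = ([::] |` vertices_from 0 F)%fset.
Proof. by apply/fsetP => v; rewrite in_tvertices !inE. Qed.

Lemma mem_vertices_from i F v :
  v \in vertices_from i F -> exists j p, v = j :: p /\ (i <= j)%N.
Proof.
rewrite in_vertices_from; elim: F i => //= t F IH i;
  rewrite mem_cat => /orP[/mapP[p _ ->]|].
  by exists i, p.
by move=> /IH[j [p [-> ij]]]; exists j, p; rewrite ltnW.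
Qed.

Lemma admissibleP c : reflect
  {in c &, forall v w, prefix v w -> v = w} (admissible c).
Proof.
apply: (iffP allrelP) => H v w vc wc;
  first by have /implyP H' := H v w vc wc => /H'/eqP.
by apply/implyP => /(H v w vc wc) ->.
Qed.

(** The root is a prefix of every vertex, so no other vertex can accompany it. *)
Lemma admissible_root (a : {fset seq nat}) : [::] \notin a ->
  admissible ([::] |` a)%fset = (a == fset0).
Proof.
move=> ra; apply/admissibleP/eqP => [H|->]; last first.
  by move=> v w; rewrite !inE !orbF => /eqP-> /eqP->.
apply/fsetP => v; rewrite inE; apply/negP => va.
have v0 : [::] = v by apply: H; rewrite ?prefix0s // !inE ?eqxx ?va ?orbT.
by rewrite -v0 (negPf ra) in va.
Qed.

Lemma admissible_imfset i (a : {fset seq nat}) : admissible (cons i @` a)%fset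
  = admissible a.
Proof.
have i_inj : injective (cons i) by move=> ? ? [].
apply/admissibleP/admissibleP => H.
  move=> v w va wa vw; apply: i_inj.
  by apply: H; rewrite ?prefix_cons ?eqxx //; apply: in_imfset.
move=> _ _ /imfsetP[v /= va ->] /imfsetP[w /= wa ->].
by rewrite prefix_cons eqxx => /H->.
Qed.

(** Vertices of different trees differ in their first entries, so neither is a prefix of the
    other. *)
Lemma admissibleU i (a b : {fset seq nat}) :
    (forall v, v \in b -> exists j p, v = j :: p /\ (i < j)%N) ->
  admissible ((cons i @` a) `|` b)%fset = admissible a && admissible b.
Proof.
move=> bi; rewrite -(admissible_imfset i a).
apply/admissibleP/andP => [H|[/admissibleP Ha /admissibleP Hb]].
  by split; apply/admissibleP => v w vc wc; apply: H; rewrite inE ?vc ?wc ?orbT.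
move=> v w; rewrite !inE => /orP[va|vb] /orP[wa|wb];
  do ?[exact: Ha | exact: Hb].
  have /imfsetP[p _ ->] := va; have [j [q [-> ij]]] := bi _ wb.
  by rewrite prefix_cons => /andP[/eqP ij']; rewrite ij' ltnn in ij.
have /imfsetP[p _ ->] := wa; have [j [q [-> ij]]] := bi _ vb.
by rewrite prefix_cons => /andP[/eqP ij']; rewrite ij' ltnn in ij.
Qed.

Lemma tree_restrict_ext t S1 S2 : S1 =1 S2 ->
  tree_restrict t S1 = tree_restrict t S2.
Proof.
elim/ptree_nested_ind: t S1 S2 => d F IH S1 S2 S12 /=; rewrite S12.
have -> : imapcat (fun i u => tree_restrict u (fun p => S1 (i :: p))) 0 F
        = imapcat (fun i u => tree_restrict u (fun p => S2 (i :: p))) 0 F;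
          last by [].
elim: F 0%N IH => //= t F IHF i [IHt /IHF->].
by rewrite (IHt _ (fun p => S2 (i :: p))).
Qed.

Lemma restrict_from_cons i t F S : restrict_from i (t :: F) S
  = tree_restrict t (fun p => S (i :: p)) ++ restrict_from i.+1 F S.
Proof. by []. Qed.

Lemma restrict_from_ext i F S1 S2 :
  (forall j p, (i <= j)%N -> S1 (j :: p) = S2 (j :: p)) ->
  restrict_from i F S1 = restrict_from i F S2.
Proof.
elim: F i => //= t F IH i S12; apply: f_equal2.
  by apply: tree_restrict_ext => p; apply: S12.
by apply: IH => j p ij; apply: S12; apply: ltnW.
Qed.

Lemma tree_restrictT t : tree_restrict t predT = [:: t].
Proof.
elim/ptree_nested_ind: t => d F IH /=; congr [:: Node d _].
by elim: F 0%N IH => //= t F IHF i [-> /IHF->].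
Qed.

Lemma tree_restrict0 t : tree_restrict t pred0 = [::].
Proof.
elim/ptree_nested_ind: t => d F /=.
by elim: F 0%N => //= t F IHF i [-> /IHF->].
Qed.

Lemma above_imfsetU i (a b : {fset seq nat}) j p :
    (forall v, v \in b -> exists j p, v = j :: p /\ (i < j)%N) -> (i <= j)%N ->
  above ((cons i @` a) `|` b)%fset (j :: p)
    = if i == j then above a p else above b (j :: p).
Proof.
move=> bi ij; apply/hasP/idP.
  move=> [v]; rewrite inE => /orP[/imfsetP[w /= wa ->]|vb].
    by move=> /andP[-> wp]; apply/hasP; exists w.
  move=> vjp; have [k [q [vE ik]]] := bi v vb.
  case: (i =P j) => [ijE|_]; last by apply/hasP; exists v.
  by move: vjp; rewrite vE prefix_cons -ijE => /andP[/eqP kE];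
    rewrite kE ltnn in ik.
case: (i =P j) => [<-|_] /hasP[v va vp].
  by exists (i :: v); rewrite ?prefix_cons ?eqxx // inE in_imfset.
by exists v; rewrite // inE va orbT.
Qed.

Lemma above_root (a : {fset seq nat}) p : [::] \in a -> above a p.
Proof. by move=> ra; apply/hasP; exists [::]; rewrite ?prefix0s. Qed.

Lemma above_nil (a : {fset seq nat}) : above a [::] = ([::] \in a).
Proof.
apply/hasP/idP => [[v va]|ra]; last by exists [::].
by rewrite prefixs0 => /eqP<-.
Qed.

Section Sums.
Variables (R : Type) (idx : R) (op : Monoid.com_law idx).

Definition tree_cut_sum t h := \big[op/idx]_(c <- fpowerset (tvertices t)
  | admissible c)
   h (tree_restrict t (above c), tree_restrict t (predC (above c))).

Definition forest_cut_sum i F h :=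
  \big[op/idx]_(c <- fpowerset (vertices_from i F) | admissible c)
     h (restrict_from i F (above c), restrict_from i F (predC (above c))).

Lemma forest_cut_sum_cons i t F h : forest_cut_sum i (t :: F) h
  = tree_cut_sum t (fun a => forest_cut_sum i.+1 F
      (fun b => h (a.1 ++ b.1, a.2 ++ b.2))).
Proof.
rewrite /forest_cut_sum vertices_from_cons big_mkcond big_fpowersetU;
  last first.
  apply/fdisjointP => _ /imfsetP[p /= _ ->]; apply/negP => /mem_vertices_from.
  by move=> [j [q [[<- _]]]]; rewrite ltnn.
rewrite big_fpowerset_imfset; last by move=> ? ? [].
rewrite /tree_cut_sum [RHS]big_mkcond; apply: eq_bigr => a _.
(* If the part [a] in [t] is not admissible, no union with it is, and the inner sum is trivial. *)
case: (boolP (admissible a)) => [aa|/negPf aa]; last first.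
  rewrite big1_seq // => b /andP[_]; rewrite fpowersetE => bF.
  by rewrite admissibleU ?aa // => v /(fsubsetP bF)/mem_vertices_from.
rewrite [RHS]big_mkcond; apply: eq_big_seq => b; rewrite fpowersetE => bF.
have bi v : v \in b -> exists j p, v = j :: p /\ (i < j)%N.
  by move=> /(fsubsetP bF)/mem_vertices_from.
rewrite admissibleU // aa andTb; case: ifP => // _; congr h.
rewrite !restrict_from_cons.
have abt p : above ((cons i @` a) `|` b)%fset (i :: p) = above a p.
  by rewrite above_imfsetU // eqxx.
have abF j p : (i < j)%N ->
    above ((cons i @` a) `|` b)%fset (j :: p) = above b (j :: p).
  by move=> ij; rewrite above_imfsetU ?ltn_eqF // ltnW.
rewrite (tree_restrict_ext _ abt) (restrict_from_ext _ abF).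
have abCt p : predC (above ((cons i @` a) `|` b)%fset) (i :: p)
  = predC (above a) p.
  by rewrite /= abt.
have abCF j p : (i < j)%N -> predC (above ((cons i @` a) `|` b)%fset) (j :: p)
    = predC (above b) (j :: p).
  by move=> ij; rewrite /= abF.
by rewrite (tree_restrict_ext _ abCt) (restrict_from_ext _ abCF).
Qed.

Lemma forest_cut_sum_nil i h : forest_cut_sum i [::] h = h ([::], [::]).
Proof.
rewrite /forest_cut_sum.
have -> : vertices_from i [::] = fset0 by apply/fsetP => v; rewrite !inE.
rewrite fpowerset0 big_mkcond big_seq_fset1.
by have -> : admissible fset0 by apply/admissibleP => v w; rewrite inE.
Qed.

Lemma tree_cut_sum_node d F h : tree_cut_sum (Node d F) h
  = op (h ([:: Node d F], [::]))
       (forest_cut_sum 0 F (fun a => h (a.1, [:: Node d a.2]))).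
Proof.
rewrite /tree_cut_sum tverticesE big_mkcond big_fpowerset1U; last first.
  by apply/negP => /mem_vertices_from[? [? []]].
have rb b : b \in fpowerset (vertices_from 0 F) -> [::] \notin b.
  rewrite fpowersetE => bF; apply/negP => /(fsubsetP bF).
  by move=> /mem_vertices_from[? [? []]].
apply: f_equal2; last first.
  rewrite -big_mkcond /forest_cut_sum big_seq_cond [RHS]big_seq_cond.
  by apply: eq_bigr => b /andP[/rb/negPf rb' _] /=; rewrite above_nil rb'.
(* Among the cuts containing the root, only the root alone is admissible. *)
rewrite (big_fsetD1 fset0) ?fpowersetE ?fsub0set // big1_seq; last first.
  move=> b /andP[_]; rewrite in_fsetD1 => /andP[b0 bF].
  by rewrite admissible_root ?rb // (negPf b0).
rewrite Monoid.mulm1 admissible_root ?in_fset0 // eqxx; congr h; congr (_, _).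
  rewrite -[RHS]tree_restrictT; apply: tree_restrict_ext => p.
  by rewrite above_root // in_fset1U eqxx.
rewrite -[RHS](tree_restrict0 (Node d F)); apply: tree_restrict_ext => p.
by rewrite /= above_root // in_fset1U eqxx.
Qed.

Lemma tree_cut_sumE t h : tree_cut_sum t h = \big[op/idx]_(p <- tcuts t) h p.
Proof.
elim/ptree_nested_ind: t h => d F IH h.
have cutE i g : forest_cut_sum i F g = \big[op/idx]_(p <- cuts F) g p.
  elim: F i g IH => [|t F IHF] i g;
    first by rewrite forest_cut_sum_nil big_seq1.
  move=> [IHt /IHF {}IHF]; rewrite forest_cut_sum_cons IHt cuts_cons.
  by rewrite big_allpairs_dep; apply: eq_bigr => a _; rewrite IHF.
by rewrite tree_cut_sum_node tcutsE big_cons big_map cutE.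
Qed.

(** This is the passage from the powerset in the definition of the coproduct to the recursive list.
    The commutative law is arbitrary, which allows sums in any module. *)
Lemma big_admissible_cuts F (h : seq (ptree D) * seq (ptree D) -> R) :
  \big[op/idx]_(c <- fpowerset (vertices F) | admissible c) h (Lea c F, Roo c F)
    = \big[op/idx]_(p <- cuts F) h p.
Proof.
rewrite -[LHS]/(forest_cut_sum 0 F h).
elim: F 0%N h => [|t F IHF] i h; first by rewrite forest_cut_sum_nil big_seq1.
rewrite forest_cut_sum_cons tree_cut_sumE cuts_cons big_allpairs_dep.
by apply: eq_bigr => a _; rewrite IHF.
Qed.

End Sums.

End PlanarCuts.

(** * Sums over cuts: coassociativity, isomorphism invariance, extreme cuts *)

Section CutSums.
Variable D : choiceType.
Implicit Types (t u : ptree D) (F G H : seq (ptree D)).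

(** Mutual induction: a forest is built from trees, a tree from the forest of its children. *)
Lemma forest_ind_of_trees (P : ptree D -> Prop) (Q : seq (ptree D) -> Prop) :
  Q [::] -> (forall t F, P t -> Q F -> Q (t :: F)) ->
  (forall d F, Q F -> P (Node d F)) -> (forall t, P t) /\ (forall F, Q F).
Proof.
move=> Q0 Qc PN; have Pt t : P t.
  elim/ptree_nested_ind: t => d F IH; apply: PN.
  by elim: F IH => // t F IHF [Pt /IHF]; apply: Qc.
by split=> // F; elim: F => // t F; apply: Qc.
Qed.

Fixpoint tsize t : nat := let: Node _ F := t in (sumn (map tsize F)).+1.

Definition fsize F : nat := sumn (map tsize F).

Lemma fsize_cat F G : fsize (F ++ G) = (fsize F + fsize G)%N.
Proof. by rewrite /fsize map_cat sumn_cat. Qed.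

Lemma fsize_gt0 F : ~~ nilp F -> (0 < fsize F)%N.
Proof. by case: F => // -[]. Qed.

Lemma cuts_size :
  (forall t p, p \in tcuts t -> (fsize p.1 + fsize p.2 = tsize t)%N) /\
  (forall F p, p \in cuts F -> (fsize p.1 + fsize p.2 = fsize F)%N).
Proof.
apply: forest_ind_of_trees => [p|t F IHt IHF p|d F IHF p].
- by rewrite inE => /eqP->.
- move=> /allpairsP[[a b] [/= /IHt aE /IHF bE ->]].
  by rewrite /= !fsize_cat addnACA aE bE.
rewrite tcutsE inE => /orP[/eqP-> /=|/mapP[a /IHF aE -> /=]].
  by rewrite /fsize /= !addn0.
by rewrite -[fsize [:: _]]/((fsize a.2).+1 + 0)%N addn0 addnS aE.
Qed.

Lemma perm_forest_iso F G : perm_eq F G -> forest_iso F G.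
Proof.
move=> FG; apply/forest_isoP; exists F => //.
by elim: F {FG} => //= t F ->; rewrite tree_iso_refl.
Qed.

Definition iso_invariant (T : Type) (f : seq (ptree D) -> T) : Prop :=
  forall F G, forest_iso F G -> f F = f G.

Definition iso_invariant2 (T : Type) (h : seq (ptree D) * seq (ptree D) ->
  T) : Prop :=
  forall F F' G G', forest_iso F F' -> forest_iso G G' -> h (F, G) = h (F', G').

Arguments cuts : simpl never.
Arguments tcuts : simpl never.

Section Sums.
Variables (R : Type) (idx : R) (op : Monoid.com_law idx).
Implicit Types (h : seq (ptree D) * seq (ptree D) -> R).

Lemma big_cuts_nil h : \big[op/idx]_(p <- cuts [::]) h p = h ([::], [::]).
Proof. exact: big_seq1. Qed.

Lemma big_cuts_cons t F h : \big[op/idx]_(p <- cuts (t :: F)) h p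
  = \big[op/idx]_(a <- tcuts t) \big[op/idx]_(b <- cuts F) h (a.1 ++ b.1,
    a.2 ++ b.2).
Proof. by rewrite cuts_cons big_allpairs_dep. Qed.

Lemma big_tcuts d F h : \big[op/idx]_(p <- tcuts (Node d F)) h p
  = op (h ([:: Node d F], [::])) (\big[op/idx]_(a <- cuts F) h (a.1,
    [:: Node d a.2])).
Proof. by rewrite tcutsE big_cons big_map. Qed.

Lemma big_cuts1 t h :
  \big[op/idx]_(p <- cuts [:: t]) h p = \big[op/idx]_(p <- tcuts t) h p.
Proof.
rewrite big_cuts_cons; apply: eq_bigr => -[a1 a2] _.
by rewrite big_cuts_nil /= !cats0.
Qed.

Lemma big_cuts_cat F G h : \big[op/idx]_(p <- cuts (F ++ G)) h p
  = \big[op/idx]_(a <- cuts F) \big[op/idx]_(b <- cuts G) h (a.1 ++ b.1,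
    a.2 ++ b.2).
Proof.
elim: F h => [|t F IH] h /=.
  by rewrite big_cuts_nil; apply: eq_bigr => -[].
rewrite !big_cuts_cons; apply: eq_bigr => a _; rewrite IH.
by apply: eq_bigr => b _; apply: eq_bigr => c _; rewrite /= !catA.
Qed.

(** Both sides run over the divisions of [F] into three layers by two nested cuts. *)
Lemma big_cuts_coassoc F (h : _ -> _ -> _ -> R) :
  \big[op/idx]_(p <- cuts F) \big[op/idx]_(q <- cuts p.1) h q.1 q.2 p.2
    = \big[op/idx]_(p <- cuts F) \big[op/idx]_(q <- cuts p.2) h p.1 q.1 q.2.
Proof.
move: F h; refine (proj2 (@forest_ind_of_trees
  (fun t => forall h : _ -> _ -> _ -> R,
   \big[op/idx]_(p <- tcuts t) \big[op/idx]_(q <- cuts p.1) h q.1 q.2 p.2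
    = \big[op/idx]_(p <- tcuts t) \big[op/idx]_(q <- cuts p.2) h p.1 q.1 q.2)
  (fun F => forall h : _ -> _ -> _ -> R,
   \big[op/idx]_(p <- cuts F) \big[op/idx]_(q <- cuts p.1) h q.1 q.2 p.2
    = \big[op/idx]_(p <- cuts F) \big[op/idx]_(q <- cuts p.2) h p.1 q.1 q.2)
  _ _ _)) => [h|t F IHt IHF h|d F IHF h].
- by rewrite !big_cuts_nil.
- rewrite !big_cuts_cons.
  (* Exchanging sums brings the two cuts of [t] together, then the two cuts of [F], so that each
     induction hypothesis applies. *)
  transitivity (\big[op/idx]_(a <- tcuts t) \big[op/idx]_(x <- cuts a.1)
    \big[op/idx]_(b <- cuts F) \big[op/idx]_(y <- cuts b.1)
      h (x.1 ++ y.1) (x.2 ++ y.2) (a.2 ++ b.2)).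
    apply: eq_bigr => a _; rewrite exchange_big /=.
    by apply: eq_bigr => b _; rewrite big_cuts_cat.
  rewrite (IHt (fun x1 x2 a2 => \big[op/idx]_(b <- cuts F)
    \big[op/idx]_(y <- cuts b.1) h (x1 ++ y.1) (x2 ++ y.2) (a2 ++ b.2))).
  apply: eq_bigr => a _.
  transitivity (\big[op/idx]_(x <- cuts a.2) \big[op/idx]_(b <- cuts F)
    \big[op/idx]_(y <- cuts b.2) h (a.1 ++ b.1) (x.1 ++ y.1) (x.2 ++ y.2)).
    apply: eq_bigr => x _.
    exact: (IHF (fun y1 y2 b2 => h (a.1 ++ y1) (x.1 ++ y2) (x.2 ++ b2))).
  by rewrite exchange_big; apply: eq_bigr => b _; rewrite big_cuts_cat.
(* Three families remain, with the root in the first, second or third layer; the last one is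
   coassociativity for [F]. *)
rewrite !big_tcuts big_cuts1 big_tcuts big_cuts_nil /= -Monoid.mulmA.
congr (op _ _).
rewrite (IHF (fun q1 q2 p2 => h q1 q2 [:: Node d p2])).
under [RHS]eq_bigr do rewrite big_cuts1 big_tcuts.
by rewrite big_split.
Qed.

Lemma big_cuts_perm F G h : iso_invariant2 h -> perm_eq F G ->
  \big[op/idx]_(p <- cuts F) h p = \big[op/idx]_(p <- cuts G) h p.
Proof.
move=> hI; elim: F G h hI => [|t F IH] G h hI tFG.
  by have /perm_nilP-> : perm_eq G [::] by rewrite perm_sym.
have tG : t \in G by rewrite -(perm_mem tFG) mem_head.
(* The cuts of [t] are moved past those of the trees preceding it in [G]; invariance of [h] absorbs
   the reordering of both components. *)
case/splitPr: tG tFG => G1 G2 tFG.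
have FG : perm_eq F (G1 ++ G2).
  by rewrite -(perm_cons t) (perm_trans tFG) // perm_sym -cat1s perm_catCA.
rewrite big_cuts_cat big_cuts_cons.
transitivity (\big[op/idx]_(a <- tcuts t) \big[op/idx]_(b <- cuts G1)
  \big[op/idx]_(c <- cuts G2) h (a.1 ++ (b.1 ++ c.1), a.2 ++ (b.2 ++ c.2))).
  apply: eq_bigr => a _.
  rewrite -(big_cuts_cat G1 G2 (fun b => h (a.1 ++ b.1, a.2 ++ b.2))).
  apply: IH => // X X' Y Y' XX YY.
  by apply: hI; apply: forest_iso_cat => //; apply: forest_iso_refl.
rewrite exchange_big; apply: eq_bigr => b _; rewrite big_cuts_cons.
apply: eq_bigr => a _; apply: eq_bigr => c _.
by apply: hI; apply: perm_forest_iso; rewrite perm_catCA.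
Qed.

Lemma big_cuts_iso F G h : iso_invariant2 h -> forest_iso F G ->
  \big[op/idx]_(p <- cuts F) h p = \big[op/idx]_(p <- cuts G) h p.
Proof.
(* [G] is first reordered into [G'], whose trees match those of [F] one by one; mutual induction
   then compares matched trees. *)
move=> hI /forest_isoP[G' /(big_cuts_perm hI)<-]; move: F G' h hI {G}.
refine (proj2 (@forest_ind_of_trees
  (fun t => forall u h, iso_invariant2 h -> tree_iso t u ->
    \big[op/idx]_(p <- tcuts t) h p = \big[op/idx]_(p <- tcuts u) h p)
  (fun F => forall G h, iso_invariant2 h -> all2 (@tree_iso D) F G ->
    \big[op/idx]_(p <- cuts F) h p = \big[op/idx]_(p <- cuts G) h p)
  _ _ _)).
- by case.
- move=> t F IHt IHF [|u G] h hI //= /andP[tu FG]; rewrite !big_cuts_cons.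
  transitivity (\big[op/idx]_(a <- tcuts t) \big[op/idx]_(b <- cuts G)
    h (a.1 ++ b.1, a.2 ++ b.2)).
    apply: eq_bigr => a _; apply: IHF => // X X' Y Y' XX YY.
    by apply: hI; apply: forest_iso_cat => //; apply: forest_iso_refl.
  apply: (IHt u (fun a => \big[op/idx]_(b <- cuts G) h (a.1 ++ b.1,
    a.2 ++ b.2))) => //.
  move=> X X' Y Y' XX YY; apply: eq_bigr => b _.
  by apply: hI; apply: forest_iso_cat => //; apply: forest_iso_refl.
move=> d F IHF [e G] h hI; rewrite tree_isoE => /andP[/eqP<- FG].
have node_iso X Y : forest_iso X Y -> forest_iso [:: Node d X] [:: Node d Y].
  move=> XY; apply/forest_isoP; exists [:: Node d Y] => //.
  by rewrite /= eqxx andbT; apply: XY.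
rewrite !big_tcuts (hI _ [:: Node d G] _ [::]) ?forest_iso_refl ?node_iso //.
congr (op _ _); have [G' G'G FG'] := forest_isoP _ _ FG.
have hI' : iso_invariant2 (fun a => h (a.1, [:: Node d a.2])).
  by move=> X X' Y Y' XX YY; apply: hI => //; apply: node_iso.
by rewrite (IHF G') // (big_cuts_perm hI' G'G).
Qed.

(** Only the empty cut has nothing above it. *)
Lemma big_cuts_nil1 F h : \big[op/idx]_(p <- cuts F | nilp p.1) h p
  = h ([::], F).
Proof.
move: F h; refine (proj2 (@forest_ind_of_trees
  (fun t => forall h, \big[op/idx]_(p <- tcuts t | nilp p.1) h p
    = h ([::], [:: t]))
  (fun F => forall h, \big[op/idx]_(p <- cuts F | nilp p.1) h p = h ([::], F))
  _ _ _)) => [h|t F IHt IHF h|d F IHF h].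
- by rewrite big_mkcond big_cuts_nil.
- rewrite big_mkcond big_cuts_cons -[RHS](IHt (fun a => h (a.1, a.2 ++ F))).
  rewrite [RHS]big_mkcond; apply: eq_bigr => -[[|x a1] a2] _ /=;
    last by rewrite big1.
  by rewrite -(IHF (fun b => h (b.1, a2 ++ b.2))) [RHS]big_mkcond.
rewrite big_mkcond big_tcuts /= Monoid.mul1m.
by rewrite -(IHF (fun a => h (a.1, [:: Node d a.2]))) [RHS]big_mkcond.
Qed.

Lemma big_cuts_split F h : \big[op/idx]_(p <- cuts F) h p
  = op (h ([::], F)) (\big[op/idx]_(p <- cuts F | ~~ nilp p.1) h p).
Proof. by rewrite (bigID (fun p => nilp p.1)) /= big_cuts_nil1. Qed.

(** Only the cut at all roots leaves nothing below: a tree cut elsewhere keeps its root in the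
    second component. *)
Lemma big_cuts_nil2 F h : \big[op/idx]_(p <- cuts F | nilp p.2) h p
  = h (F, [::]).
Proof.
elim: F h => [|[d G] F IHF] h; first by rewrite big_mkcond big_cuts_nil.
rewrite big_mkcond big_cuts_cons big_tcuts /= [X in op _ X]big1 ?Monoid.mulm1.
  by rewrite -(IHF (fun b => h (Node d G :: b.1, b.2))) [RHS]big_mkcond.
by move=> a _; rewrite big1.
Qed.

End Sums.
End CutSums.

(** * Prepending a letter in the quasi-shuffle algebra *)

Section LinearCombinators.
Variable K : fieldType.
Variables (U : lmodType K) (A B : choiceType) (V : lmodType K) (g : A ->
  B -> V).

Lemma linear_id : linear (fun x : U => x). Proof. by []. Qed.

Lemma linear_bilext_l (f : U -> {malg K[A]}) y :
  linear f -> linear (fun x => bilext g (f x) y).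
Proof. by move=> lf a x x'; rewrite lf bilextDl bilextZl. Qed.

Lemma linear_bilext_r (f : U -> {malg K[B]}) x :
  linear f -> linear (fun y => bilext g x (f y)).
Proof. by move=> lf a y y'; rewrite lf bilextDr bilextZr. Qed.

Lemma linear_linext (C : choiceType) (h : C -> V) (f : U -> {malg K[C]}) :
  linear f -> linear (fun x => linext h (f x)).
Proof. by move=> lf a x x'; rewrite lf linext_is_linear. Qed.

Lemma linear_add (f f' : U -> V) :
  linear f -> linear f' -> linear (fun x => f x + f' x).
Proof. by move=> lf lf' a x y; rewrite lf lf' scalerDr addrACA. Qed.

Lemma linear_scale (f : U -> K^o) (v : V) :
  linear f -> linear (fun x => (f x : K) *: v).
Proof. by move=> lf a x y; rewrite lf scalerDl scalerA. Qed.

Lemma linear_scaler (f : U -> V) (c : K) :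
  linear f -> linear (fun x => c *: f x).
Proof. by move=> lf a x y; rewrite lf scalerDr !scalerA mulrC. Qed.

Lemma linear_mcoeff (C : choiceType) (f : U -> {malg K[C]}) c :
  linear f -> linear (fun x => (f x)@_c : K^o).
Proof. by move=> lf a x y; rewrite lf mcoeffD mcoeffZ. Qed.

End LinearCombinators.

Ltac linearity := repeat first
  [ exact: linear_id | apply: linear_add | apply: linear_bilext_l
  | apply: linear_bilext_r | apply: linear_linext ].

(** * Product, deconcatenation and projection in terms of first letters *)

Section QuasiShuffleAlgebra.
Variables (K : fieldType) (D : choiceType) (op : D -> D -> D).

Local Notation W := {malg K[seq D]}.
Local Notation KD := {malg K[D]}.

Definition opm : KD -> KD -> KD := bilext (fun a b => << op a b >>).

Lemma opmA : associative op -> associative opm.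
Proof.
move=> opA x y z; move: x; apply: eq_linear; rewrite /opm; [linearity..|] => a.
move: y; apply: eq_linear; [linearity..|] => b.
move: z; apply: eq_linear; [linearity..|] => c.
by rewrite !bilextUU opA.
Qed.

Lemma opmC : commutative op -> commutative opm.
Proof.
move=> opC x y; move: x; apply: eq_linear; rewrite /opm; [linearity..|] => a.
move: y; apply: eq_linear; [linearity..|] => b.
by rewrite !bilextUU opC.
Qed.

(** The prepended letter may be a linear combination of letters, as the values of [phi] are. *)
Definition ccons : KD -> W -> W := bilext (fun d w => << d :: w >>).

Definition qsh : W -> W -> W := bilext (qsh_prod_word K op).

Lemma qsh1l X : qsh << [::] >> X = X.
Proof.
move: X; apply: eq_linear; rewrite /qsh; [linearity..|] => u.
by rewrite bilextUU qsh_prod_word_nil_l.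
Qed.

Lemma qsh1r X : qsh X << [::] >> = X.
Proof.
move: X; apply: eq_linear; rewrite /qsh; [linearity..|] => u.
by rewrite bilextUU qsh_prod_word_nil_r.
Qed.

Lemma wcons_ccons d Z : wcons d Z = ccons << d >> Z.
Proof.
rewrite /ccons; move: Z; apply: eq_linear.
- exact: linext_is_linear.
- linearity.
by move=> w; rewrite wconsU bilextUU.
Qed.

Lemma qsh_ccons x X y Y : qsh (ccons x X) (ccons y Y)
  = ccons x (qsh X (ccons y Y)) + ccons y (qsh (ccons x X) Y)
    + ccons (opm x y) (qsh X Y).
Proof.
rewrite /qsh /ccons /opm.
move: x; apply: eq_linear; [linearity..|] => a.
move: X; apply: eq_linear; [linearity..|] => u.
move: y; apply: eq_linear; [linearity..|] => b.
move: Y; apply: eq_linear; [linearity..|] => v.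
by rewrite !bilextUU qsh_prod_word_cons !wcons_ccons.
Qed.

Lemma ccons0 X : ccons 0 X = 0. Proof. exact: bilext0l. Qed.

Lemma ccons_sum (I : Type) (r : seq I) (P : pred I) (E : I -> W) x :
  ccons x (\sum_(i <- r | P i) E i) = \sum_(i <- r | P i) ccons x (E i).
Proof. exact: bilext_sumr. Qed.

Lemma qsh_suml (I : Type) (r : seq I) (P : pred I) (E : I -> W) Y :
  qsh (\sum_(i <- r | P i) E i) Y = \sum_(i <- r | P i) qsh (E i) Y.
Proof. exact: bilext_suml. Qed.

Lemma qsh_sumr (I : Type) (r : seq I) (P : pred I) (E : I -> W) X :
  qsh X (\sum_(i <- r | P i) E i) = \sum_(i <- r | P i) qsh X (E i).
Proof. exact: bilext_sumr. Qed.

Lemma mcoeff_ccons_nil x X : (ccons x X)@_[::] = 0.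
Proof.
rewrite /ccons /bilext /linext raddf_sum big1 // => d _ /=.
rewrite mcoeffZ raddf_sum big1 ?mulr0 // => w _ /=.
by rewrite mcoeffZ mcoeffU mulr0.
Qed.

Lemma Csh_proj_ccons x X : Csh_proj (ccons x X) = X@_[::] *: x.
Proof.
rewrite /Csh_proj /ccons.
move: x; apply: (@eq_linear K D {malg K[D]}) => [||d].
- linearity.
- exact/linear_scaler/linear_id.
move: X; apply: (@eq_linear K (seq D) {malg K[D]}) => [||w].
- linearity.
- exact/linear_scale/linear_mcoeff/linear_id.
rewrite bilextUU linextU mcoeffU; case: w => [|a w] /=.
  by rewrite scale1r.
by rewrite scale0r.
Qed.

Lemma Csh_proj1 : Csh_proj << [::] >> = 0 :> KD.
Proof. exact: linextU. Qed.

Lemma Csh_cop1 : @Csh_cop K D << [::] >> = tens << [::] >> << [::] >>.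
Proof. by rewrite /Csh_cop linextU big_ord1 tensE bilextUU. Qed.

Definition cop_cons (x : KD) : tensor K (seq D) (seq D) ->
  tensor K (seq D) (seq D) :=
  bilext (fun d uv => << (d :: uv.1, uv.2) >>) x.

Lemma cop_cons0 z : cop_cons 0 z = 0. Proof. exact: bilext0l. Qed.

Lemma cop_cons_sum (I : Type) (r : seq I) (P : pred I)
    (E : I -> tensor K (seq D) (seq D)) x :
  cop_cons x (\sum_(i <- r | P i) E i) = \sum_(i <- r | P i) cop_cons x (E i).
Proof. exact: bilext_sumr. Qed.

Lemma cop_cons_tens x X Y : cop_cons x (tens X Y) = tens (ccons x X) Y.
Proof.
rewrite /cop_cons /ccons !tensE.
move: x; apply: eq_linear; [linearity..|] => d.
move: X; apply: eq_linear; [linearity..|] => u.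
move: Y; apply: eq_linear; [linearity..|] => v.
by rewrite !bilextUU.
Qed.

(** A splitting of [d :: w] either takes place before [d] or keeps [d] at the head of the left
    factor. *)
Lemma Csh_cop_ccons x X :
  Csh_cop (ccons x X) = tens << [::] >> (ccons x X) + cop_cons x (Csh_cop X).
Proof.
rewrite /Csh_cop /cop_cons /ccons !tensE.
move: x; apply: eq_linear; [linearity..|] => d.
move: X; apply: eq_linear; [linearity..|] => w.
rewrite !bilextUU !linextU /= big_ord_recl bilext_sumr /=.
by apply: f_equal2 => //; apply: eq_bigr => i _; rewrite bilextUU.
Qed.

(** This is [Csh_proj] on the left tensor factor, followed by concatenation. *)
Definition uncop : tensor K (seq D) (seq D) -> W :=
  linext (fun uv => if uv.1 is [:: d] then << d :: uv.2 >> else 0).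

Lemma uncop_tens X Y : uncop (tens X Y) = ccons (Csh_proj X) Y.
Proof.
rewrite /uncop /ccons /Csh_proj !tensE.
move: X; apply: eq_linear; [linearity..|] => u.
move: Y; apply: eq_linear; [linearity..|] => v.
rewrite bilextUU !linextU /=; case: u => [|d [|d' u]]; rewrite ?bilext0l //.
by rewrite bilextUU.
Qed.

(** Cofreeness in concrete form: among the splittings of a nonempty word only the one after the
    first letter survives [uncop], and it restores the word. Uniqueness rests on this. *)
Lemma uncop_Csh_cop X : X = X@_[::] *: << [::] >> + uncop (Csh_cop X).
Proof.
rewrite /uncop /Csh_cop; move: X; apply: (@eq_linear K (seq D) W) => [||w].
- exact: linear_id.
- apply: linear_add; last by linearity.
  exact/linear_scale/linear_mcoeff/linear_id.
rewrite linextU linear_sum mcoeffU /=; case: w => [|d w] /=.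
  by rewrite big_ord1 linextU /= scale1r addr0.
rewrite scale0r add0r !big_ord_recl !linextU /= add0r take0 drop0.
rewrite big1 ?addr0 // => i _; rewrite linextU /=.
by case: w i => [[]|d' w i] //.
Qed.

Lemma mcoeff_qsh_prod_word_nil (u v : seq D) :
  (qsh_prod_word K op u v)@_[::] = (nilp u && nilp v)%:R.
Proof.
case: u => [|a u]; first by rewrite qsh_prod_word_nil_l mcoeffU; case: v.
case: v => [|b v]; first by rewrite qsh_prod_word_nil_r mcoeffU.
by rewrite qsh_prod_word_cons !wcons_ccons !mcoeffD !mcoeff_ccons_nil !addr0.
Qed.

(** On elements without constant term only the last summand remains, so [Csh_proj] turns [qsh] into
    [opm]. *)
Lemma Csh_proj_qsh X Y : Csh_proj (qsh X Y)
  = X@_[::] *: Csh_proj Y + Y@_[::] *: Csh_proj X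
    + opm (Csh_proj X) (Csh_proj Y).
Proof.
have linP (U : lmodType K) (f : U -> W) : linear f -> linear (fun x =>
  Csh_proj (f x)).
  exact: linear_linext.
have lin0 (U : lmodType K) (f : U -> W) : linear f -> linear (fun x =>
  (f x)@_[::] : K^o).
  exact: linear_mcoeff.
rewrite /qsh /opm.
move: X; apply: (@eq_linear K (seq D) KD) => [||u].
- by apply: linP; linearity.
- apply: linear_add; last by apply: linear_bilext_l; apply: linP; linearity.
  apply: linear_add; first by apply: linear_scale; apply: lin0; linearity.
  by apply: linear_scaler; apply: linP; linearity.
move: Y; apply: (@eq_linear K (seq D) KD) => [||v].
- by apply: linP; linearity.
- apply: linear_add; last by apply: linear_bilext_r; apply: linP; linearity.
  apply: linear_add; first by apply: linear_scaler; apply: linP; linearity.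
  by apply: linear_scale; apply: lin0; linearity.
rewrite bilextUU !mcoeffU; case: u => [|a u].
  rewrite qsh_prod_word_nil_l Csh_proj1 bilext0l addr0 scaler0 addr0.
  by rewrite scale1r.
case: v => [|b v].
  by rewrite qsh_prod_word_nil_r Csh_proj1 bilext0r scaler0 addr0 add0r scale1r.
rewrite qsh_prod_word_cons !wcons_ccons /Csh_proj !linearD /=.
(* Each term contributes its prepended letter times the constant coefficient of the rest. This is
   zero in the first two terms, and nonzero in the third only if [u] and [v] are empty. *)
rewrite -!/(Csh_proj _) !Csh_proj_ccons !mcoeff_qsh_prod_word_nil /= andbF
  !scale0r.
rewrite !add0r /Csh_proj !linextU; case: u => [|a' u]; case: v => [|b' v] /=.
- by rewrite bilextUU scale1r.
- by rewrite bilext0r scale0r.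
- by rewrite bilext0l scale0r.
- by rewrite bilext0l scale0r.
Qed.

End QuasiShuffleAlgebra.

(** * The morphism *)

Section PlanarMorphism.
Local Open Scope quotient_scope.
Variables (K : fieldType) (D : choiceType) (op : D -> D -> D).
Hypotheses (opA : associative op) (opC : commutative op).
Variable phi : {malg K[tree D]} -> {malg K[D]}.

Local Notation W := {malg K[seq D]}.
Local Notation KD := {malg K[D]}.
Local Notation pforest := (seq (ptree D)).
Implicit Types (F G : pforest).
Local Notation qsh := (@qsh K D op).
Local Notation opm := (@opm K D op).

(** [oAC] adjoins a unit [None] to [opm], which makes the iterated product a big operator over a
    commutative monoid. Associativity and commutativity of [op] enter here. *)
Definition phi_prod F : option KD :=
  \big[oAC (@opmA K D op opA) (@opmC K D op opC)/None]_(t <- F) Some (phi <<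
    \pi_(tree D) t >>).

(* The empty forest is sent to [0]: there is no unit in [D]. *)
Definition phi_ext F : KD := odflt 0 (phi_prod F).

Lemma phi_prod_cons t F : exists x, phi_prod (t :: F) = Some x.
Proof. by rewrite /phi_prod big_cons; case: (\big[_/_]_(_ <- _) _) => [y|];
  eexists. Qed.

Lemma phi_ext0 : phi_ext [::] = 0.
Proof. by rewrite /phi_ext /phi_prod big_nil. Qed.

Lemma phi_ext1 t : phi_ext [:: t] = phi << \pi_(tree D) t >>.
Proof. by rewrite /phi_ext /phi_prod big_seq1. Qed.

(** Both forests must be nonempty, since the empty one is sent to 0 and not to a unit. *)
Lemma phi_ext_cat F G : ~~ nilp F -> ~~ nilp G ->
  phi_ext (F ++ G) = opm (phi_ext F) (phi_ext G).
Proof.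
case: F => // t F _; case: G => // u G _.
rewrite /phi_ext {1}/phi_prod big_cat -!/(phi_prod _).
by have [x ->] := phi_prod_cons t F; have [y ->] := phi_prod_cons u G.
Qed.

Lemma phi_ext_iso : iso_invariant phi_ext.
Proof.
move=> F G /forest_isoP[G' G'G FG'].
rewrite /phi_ext /phi_prod -(perm_big _ G'G); congr odflt.
elim: F G' FG' {G'G} => [|t F IH] [|u G'] //= /andP[tu /IH E].
have tuE : \pi_(tree D) t = \pi_(tree D) u by exact/(eqmodP (tree_iso_equiv D)).
by rewrite !big_cons E tuE.
Qed.

(** The counit followed by the unit, on planar forests. *)
Definition ceps F : W := if nilp F then << [::] >> else 0.

(** [p.2] is not a subterm of [F], but it has fewer vertices when [p.1] is nonempty. Fuel exceeding
    [fsize F] therefore never runs out, and the default 0 is not reached. *)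
Fixpoint Phi_fuel n F : W := if n is n'.+1 then
  ceps F + \sum_(p <- cuts F | ~~ nilp p.1) ccons (phi_ext p.1) (Phi_fuel n'
    p.2)
  else 0.

Definition Phi F : W := Phi_fuel (fsize F).+1 F.

Lemma fsize_cut F p : p \in cuts F -> ~~ nilp p.1 -> (fsize p.2 < fsize F)%N.
Proof.
case: (cuts_size D) => _ H /H <- /fsize_gt0 p1.
by rewrite -[X in (X < _)%N]add0n ltn_add2r.
Qed.

Lemma Phi_fuelE n m F : (fsize F < n)%N -> (fsize F < m)%N ->
  Phi_fuel n F = Phi_fuel m F.
Proof.
elim: n m F => [//|n IH] [//|m] F Fn Fm.
rewrite [LHS]/= [RHS]/=.
apply: f_equal2; first by [].
rewrite big_seq_cond [RHS]big_seq_cond; apply: eq_bigr => p /andP[pF p1].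
have lt := fsize_cut pF p1.
by rewrite (IH m) // (leq_trans lt).
Qed.

Lemma PhiE F : Phi F
  = ceps F + \sum_(p <- cuts F | ~~ nilp p.1) ccons (phi_ext p.1) (Phi p.2).
Proof.
rewrite {1}/Phi [LHS]/=; apply: f_equal2; first by [].
rewrite big_seq_cond [RHS]big_seq_cond; apply: eq_bigr => p /andP[pF p1].
by rewrite /Phi; congr ccons; apply: Phi_fuelE; rewrite ?fsize_cut.
Qed.

(** The cut with nothing above it adds 0 because [phi_ext] vanishes on the empty forest. Sums over
    all cuts are the ones to which coassociativity and concatenation apply. *)
Lemma PhiE_all F :
  Phi F = ceps F + \sum_(p <- cuts F) ccons (phi_ext p.1) (Phi p.2).
Proof.
rewrite {1}PhiE; apply: f_equal2; first by [].
rewrite [RHS](bigID (fun p => nilp p.1)) /= [X in _ = X + _]big1 ?add0r // => p.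
by move=> /nilP->; rewrite phi_ext0 ccons0.
Qed.

Lemma forest_iso_nilp F G : forest_iso F G -> nilp F = nilp G.
Proof.
move=> FG; apply/nilP/nilP => E; rewrite E in FG; last exact: forest_iso_nil FG.
by apply: forest_iso_nil; rewrite forest_iso_sym.
Qed.

Lemma Phi_fuel_iso n : iso_invariant (Phi_fuel n).
Proof.
elim: n => // n IH F G FG /=; apply: f_equal2.
  by rewrite /ceps (forest_iso_nilp FG).
rewrite big_mkcond [RHS]big_mkcond;
  apply: big_cuts_iso FG => X X' Y Y' XX YY /=.
by rewrite (forest_iso_nilp XX) (phi_ext_iso XX) (IH _ _ YY).
Qed.

Lemma Phi_iso : iso_invariant Phi.
Proof.
(* One amount of fuel large enough for both forests. *)
move=> F G FG; pose N := (fsize F + fsize G).+1.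
have -> : Phi F = Phi_fuel N F by apply: Phi_fuelE; rewrite ltnS // leq_addr.
have -> : Phi G = Phi_fuel N G by apply: Phi_fuelE; rewrite ltnS // leq_addl.
exact: Phi_fuel_iso.
Qed.

Lemma Phi0 : Phi [::] = << [::] >>.
Proof. by rewrite PhiE big_mkcond big_cuts_nil /= addr0. Qed.

Lemma Phi_cons_sum F : ~~ nilp F -> Phi F
  = \sum_(p <- cuts F | ~~ nilp p.1) ccons (phi_ext p.1) (Phi p.2).
Proof. by move=> /negPf F0; rewrite {1}PhiE /ceps F0 add0r. Qed.

Lemma sum_cuts_split F (h : pforest -> pforest -> W) :
  \sum_(p <- cuts F) h p.1 p.2
    = h [::] F + \sum_(p <- cuts F | ~~ nilp p.1) h p.1 p.2.
Proof. exact: (big_cuts_split _ F (fun p => h p.1 p.2)). Qed.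

Lemma sum_cuts_cat F G (h : pforest -> pforest -> W) :
  \sum_(p <- cuts (F ++ G)) h p.1 p.2
    = \sum_(a <- cuts F) \sum_(b <- cuts G) h (a.1 ++ b.1) (a.2 ++ b.2).
Proof. exact: (big_cuts_cat _ F G (fun p => h p.1 p.2)). Qed.

Lemma Phi_cat F G : Phi (F ++ G) = qsh (Phi F) (Phi G).
Proof.
have [n] := ubnP (fsize F + fsize G); elim: n F G => // n IH F G Fn.
have [F0|F0] := boolP (nilp F); first by rewrite (nilP F0) cat0s Phi0 qsh1l.
have [G0|G0] := boolP (nilp G); first by rewrite (nilP G0) cats0 Phi0 qsh1r.
have FG0 : ~~ nilp (F ++ G) by rewrite cat_nilp negb_and F0.
have IHl p : p \in cuts F -> ~~ nilp p.1 ->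
    Phi (p.2 ++ G) = qsh (Phi p.2) (Phi G).
  move=> pF p0; apply: IH; rewrite -ltnS; apply: leq_trans Fn; rewrite ltnS.
  by rewrite ltn_add2r fsize_cut.
have IHr q : q \in cuts G -> ~~ nilp q.1 ->
    Phi (F ++ q.2) = qsh (Phi F) (Phi q.2).
  move=> qG q0; apply: IH; rewrite -ltnS; apply: leq_trans Fn; rewrite ltnS.
  by rewrite ltn_add2l fsize_cut.
have IHb p q : p \in cuts F -> ~~ nilp p.1 -> q \in cuts G -> ~~ nilp q.1 ->
    Phi (p.2 ++ q.2) = qsh (Phi p.2) (Phi q.2).
  move=> pF p0 qG q0; apply: IH; rewrite -ltnS; apply: leq_trans Fn;
    rewrite ltnS.
  by rewrite -addSn; apply: leq_add; rewrite ?fsize_cut // ltnW ?fsize_cut.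
(* The cuts of [F ++ G] are sorted by what lies above them: vertices of [F] only in [A], of [G] only
   in [B], of both in [C]. The same three sums arise from the first-letter recursion of [qsh]. *)
pose A := \sum_(p <- cuts F | ~~ nilp p.1) ccons (phi_ext p.1) (qsh (Phi p.2)
  (Phi G)).
pose B := \sum_(q <- cuts G | ~~ nilp q.1) ccons (phi_ext q.1) (qsh (Phi F)
  (Phi q.2)).
pose C := \sum_(p <- cuts F | ~~ nilp p.1) \sum_(q <- cuts G | ~~ nilp q.1)
  ccons (opm (phi_ext p.1) (phi_ext q.1)) (qsh (Phi p.2) (Phi q.2)).
transitivity (A + B + C).
  pose h X Y := ccons (phi_ext X) (Phi Y).
  rewrite PhiE_all /ceps (negPf FG0) add0r (sum_cuts_cat F G h).
  rewrite (sum_cuts_split F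
    (fun X Y => \sum_(b <- cuts G) h (X ++ b.1) (Y ++ b.2))).
  rewrite [A + B]addrC -addrA; apply: f_equal2.
    rewrite (sum_cuts_split G (fun X Y => h X (F ++ Y))).
    rewrite {1}/h phi_ext0 ccons0 add0r.
    rewrite big_seq_cond [RHS]big_seq_cond.
    by apply: eq_bigr => q /andP[qG q0]; rewrite /h (IHr q qG q0).
  rewrite -big_split /= big_seq_cond [RHS]big_seq_cond.
  apply: eq_bigr => p /andP[pF p0].
  rewrite (sum_cuts_split G (fun X Y => h (p.1 ++ X) (p.2 ++ Y))).
  rewrite {1}/h cats0 (IHl p pF p0); apply: f_equal2; first by [].
  rewrite big_seq_cond [RHS]big_seq_cond.
  apply: eq_bigr => q /andP[qG q0].
  by rewrite /h (IHb p q pF p0 qG q0) (phi_ext_cat p0 q0).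
(* The product side: both factors are expanded, [qsh_ccons] gives three double sums, and one
   expansion is folded back in each of the first two. *)
rewrite /A /B /C [in RHS](Phi_cons_sum F0) [in RHS](Phi_cons_sum G0).
rewrite qsh_suml.
under [RHS]eq_bigr => p _.
  rewrite qsh_sumr; under eq_bigr => q _ do rewrite qsh_ccons.
  rewrite !big_split /=; over.
rewrite !big_split /=; apply: f_equal2; last by [].
apply: f_equal2.
  apply: eq_bigr => p _; rewrite [in LHS](Phi_cons_sum G0).
  by rewrite qsh_sumr ccons_sum.
rewrite exchange_big; apply: eq_bigr => q _; rewrite [in LHS](Phi_cons_sum F0).
by rewrite qsh_suml ccons_sum.
Qed.

Lemma mcoeff_Phi_nil F : (Phi F)@_[::] = (nilp F)%:R.
Proof.
rewrite PhiE mcoeffD raddf_sum /= big1 ?addr0 => [|p _];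
  last exact: mcoeff_ccons_nil.
by rewrite /ceps; case: (nilp F); rewrite ?mcoeffUU ?mcoeff0.
Qed.

Lemma Csh_proj_sum (I : Type) (r : seq I) (P : pred I) (E : I -> W) :
  Csh_proj (\sum_(i <- r | P i) E i) = \sum_(i <- r | P i) Csh_proj (E i).
Proof. exact: linear_sum. Qed.

Lemma Csh_copD (X Y : W) : Csh_cop (X + Y) = Csh_cop X + Csh_cop Y.
Proof. exact: linearD. Qed.

Lemma Csh_cop_sum (I : Type) (r : seq I) (P : pred I) (E : I -> W) :
  Csh_cop (\sum_(i <- r | P i) E i) = \sum_(i <- r | P i) Csh_cop (E i).
Proof. exact: linear_sum. Qed.

Lemma Csh_proj_Phi F : Csh_proj (Phi F) = phi_ext F.
Proof.
rewrite PhiE_all /Csh_proj linearD /= -!/(Csh_proj _) Csh_proj_sum.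
have -> : Csh_proj (ceps F) = 0 :> KD.
  by rewrite /ceps; case: (nilp F); [exact: Csh_proj1 | exact: linear0].
(* A cut contributes only if [Phi p.2] has a constant term, that is, if [p.2] is empty; this leaves
   the cut at all roots. *)
rewrite add0r; transitivity (\sum_(p <- cuts F | nilp p.2) phi_ext p.1).
  2: exact: (big_cuts_nil2 _ F (fun p => phi_ext p.1)).
rewrite [RHS]big_mkcond; apply: eq_bigr => p _;
  rewrite Csh_proj_ccons mcoeff_Phi_nil.
by case: ifP; rewrite ?scale1r ?scale0r.
Qed.

Lemma Csh_cop_Phi F :
  Csh_cop (Phi F) = \sum_(p <- cuts F) tens (Phi p.1) (Phi p.2).
Proof.
have [n] := ubnP (fsize F); elim: n F => // n IH F Fn.
have ceps_cop : Csh_cop (ceps F) = tens << [::] >> (ceps F).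
  rewrite /ceps; case: (nilp F); first exact: Csh_cop1.
  by rewrite tens0r; apply: linear0.
(* When [p.1] is empty, [p.2] need not be smaller than [F], but both sides vanish with [phi_ext]. *)
have IHp p : p \in cuts F -> cop_cons (phi_ext p.1) (Csh_cop (Phi p.2))
    = \sum_(q <- cuts p.2) tens (ccons (phi_ext p.1) (Phi q.1)) (Phi q.2).
  have [/nilP-> _|p0 pF] := boolP (nilp p.1).
    rewrite phi_ext0 cop_cons0 big1 => [|q _]; first by [].
    by rewrite ccons0 tens0l.
  rewrite IH; last exact: leq_trans (fsize_cut pF p0) _.
  rewrite cop_cons_sum; apply: eq_bigr => q _.
  exact: cop_cons_tens.
transitivity (tens << [::] >> (Phi F) + \sum_(p <- cuts F)
    \sum_(q <- cuts p.2) tens (ccons (phi_ext p.1) (Phi q.1)) (Phi q.2)).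
  rewrite [in LHS]PhiE_all Csh_copD ceps_cop Csh_cop_sum [in RHS]PhiE_all.
  rewrite tensDr -addrA; apply: f_equal2; first by [].
  rewrite tens_sumr -big_split /=; apply: eq_big_seq => p pF.
  by rewrite Csh_cop_ccons IHp.
(* The first term becomes the contribution of the empty cut, and coassociativity regroups the double
   sum by its outer right factor. For each [p], the left factors then add up to [Phi p.1]. *)
transitivity (\sum_(p <- cuts F | nilp p.1) tens << [::] >> (Phi p.2)
    + \sum_(p <- cuts F)
    \sum_(q <- cuts p.1) tens (ccons (phi_ext q.1) (Phi q.2)) (Phi p.2)).
  apply: f_equal2.
    exact/esym/(big_cuts_nil1 _ F (fun p => tens << [::] >> (Phi p.2))).
  exact/esym/(big_cuts_coassoc _ F
    (fun x y z => tens (ccons (phi_ext x) (Phi y)) (Phi z))).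
rewrite big_mkcond -big_split /=; apply: eq_bigr => p _.
rewrite [in RHS]PhiE_all tensDl; apply: f_equal2; last by rewrite tens_suml.
by rewrite /ceps; case: (nilp p.1); [exact: erefl | rewrite tens0l].
Qed.

End PlanarMorphism.

(** * Passage to isomorphism classes, and existence *)

Section Morphism.
Local Open Scope quotient_scope.
Variables (K : fieldType) (D : choiceType) (op : D -> D -> D).
Hypotheses (opA : associative op) (opC : commutative op).
Variable phi : {linear {malg K[tree D]} -> {malg K[D]}}.

Local Notation W := {malg K[seq D]}.
Local Notation H := {malg K[forest D]}.
Local Notation pforest := (seq (ptree D)).
Local Notation Phi := (Phi opA opC phi).
Local Notation phi_ext := (phi_ext opA opC phi).
Local Notation basis F := (<< \pi_(forest D) F >> : H).
Implicit Types (F G : pforest).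

Lemma forest_pi_ind (P : forest D -> Prop) :
  (forall F, P (\pi_(forest D) F)) -> forall x, P x.
Proof. by move=> PF x; rewrite -[x]reprK. Qed.

Lemma forest_pi_eq_unit F : (\pi_(forest D) F == forest_unit D) = nilp F.
Proof. by apply/eqP/nilP => [/forest_piP/forest_iso_nil|->]. Qed.

Lemma HCK_mul_basis F G : basis F * basis G = basis (F ++ G).
Proof.
rewrite malgM_def fgmulUU mulr1; congr << _ >>; exact: forest_union_pi.
Qed.

(** The coproduct is defined on the chosen representative [repr]; isomorphism invariance of cut sums
    allows any planar representative. *)
Lemma HCK_cop_basis F : HCK_cop (basis F)
  = \sum_(p <- cuts F) << (\pi_(forest D) p.1, \pi_(forest D) p.2) >>.
Proof.
rewrite /HCK_cop linextU /HCK_cop_forest.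
transitivity (\sum_(p <- cuts (repr (\pi_(forest D) F)))
   << (\pi_(forest D) p.1, \pi_(forest D) p.2) >> : tensor K (forest D) (forest
     D)).
  exact: (big_admissible_cuts _ _
    (fun p => << (\pi_(forest D) p.1, \pi_(forest D) p.2) >>)).
apply: (big_cuts_iso _ (h := fun p =>
  << (\pi_(forest D) p.1, \pi_(forest D) p.2) >>)).
  by move=> X X' Y Y' /forest_piP XX /forest_piP YY; rewrite XX YY.
exact: forest_reprP.
Qed.

Lemma HCK_incl_basis (t : tree D) : HCK_incl << t >> = basis [:: repr t] :> H.
Proof. exact: linextU. Qed.

Definition Phi_linear : H -> W := linext (fun x : forest D => Phi (repr x)).

HB.instance Definition _ :=
  GRing.isLinear.Build K (HCK K D) (Csh K D) *:%R Phi_linear (linext_is_linear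
    _).

Lemma Phi_linear_basis F : Phi_linear (basis F) = Phi F.
Proof. by rewrite /Phi_linear linextU; apply/Phi_iso/forest_reprP. Qed.

Lemma tens_map_basis (Psi : H -> W) (X Y : pforest) :
  tens_map Psi Psi << (\pi_(forest D) X, \pi_(forest D) Y) >>
    = tens (Psi (basis X)) (Psi (basis Y)).
Proof. exact: linextU. Qed.

Lemma tens_map_HCK_cop (Psi : H -> W) F :
  tens_map Psi Psi (HCK_cop (basis F))
    = \sum_(p <- cuts F) tens (Psi (basis p.1)) (Psi (basis p.2)).
Proof.
rewrite HCK_cop_basis /tens_map linear_sum; apply: eq_bigr => p _.
exact: tens_map_basis.
Qed.

Lemma Phi_hopf_morphism : hopf_morphism op (Phi_linear : {linear HCK K D ->
  Csh K D}).
Proof.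
split.
- transitivity (Phi_linear (basis [::])); first by [].
  by rewrite Phi_linear_basis Phi0.
(* [qsh] and [qsh_prod] are convertible; bilinearity then reduces multiplicativity to [Phi_cat] on
   basis forests. *)
- move=> x y; change (Phi_linear (x * y)
    = qsh op (Phi_linear x) (Phi_linear y)).
  rewrite /qsh; move: x; apply: (@eq_linear K (forest D) W).
  + move=> a x x'; rewrite mulrDl -scalerAl; exact: linext_is_linear.
  + by apply: linear_bilext_l; apply: linext_is_linear.
  apply: forest_pi_ind => F.
  move: y; apply: (@eq_linear K (forest D) W).
  + move=> a y y'; rewrite mulrDr -scalerAr; exact: linext_is_linear.
  + by apply: linear_bilext_r; apply: linext_is_linear.
  apply: forest_pi_ind => G.
  by rewrite HCK_mul_basis !Phi_linear_basis Phi_cat.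
- move=> x; change ((Phi_linear x)@_[::] = x@_(forest_unit D)).
  move: x; apply: (@eq_linear K (forest D) K^o).
  + by apply: linear_mcoeff; apply: linext_is_linear.
  + by apply: linear_mcoeff.
  apply: forest_pi_ind => F; rewrite Phi_linear_basis mcoeff_Phi_nil mcoeffU1.
  by rewrite forest_pi_eq_unit.
move=> x; change (Csh_cop (Phi_linear x)
  = tens_map Phi_linear Phi_linear (HCK_cop x)).
move: x; apply: eq_linear.
- by apply: linear_linext; apply: linext_is_linear.
- by apply: linear_linext; apply: linext_is_linear.
apply: forest_pi_ind => F; rewrite Phi_linear_basis Csh_cop_Phi
  tens_map_HCK_cop.
by apply: eq_bigr => p _; rewrite !Phi_linear_basis.
Qed.

Lemma Csh_proj_Phi_linear x : Csh_proj (Phi_linear (HCK_incl x)) = phi x.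
Proof.
move: x; apply: eq_linear.
- by apply: linear_linext; apply: linear_linext; apply: linext_is_linear.
- exact: linearP.
move=> t; rewrite HCK_incl_basis Phi_linear_basis Csh_proj_Phi phi_ext1.
by rewrite reprK.
Qed.

(** * Uniqueness of the morphism *)

Section Uniqueness.
Variable Psi : {linear HCK K D -> Csh K D}.
Hypothesis Psi_hopf : hopf_morphism op Psi.
Hypothesis Psi_proj : forall x, Csh_proj (Psi (HCK_incl x)) = phi x.

Let PsiF F : W := Psi (basis F).

Lemma PsiF0 : PsiF [::] = << [::] >>.
Proof. by case: Psi_hopf. Qed.

Lemma PsiF_cat F G : PsiF (F ++ G) = qsh op (PsiF F) (PsiF G).
Proof. by case: Psi_hopf => _ PsiM _ _; rewrite /PsiF -HCK_mul_basis;
  apply: PsiM. Qed.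

Lemma mcoeff_PsiF_nil F : (PsiF F)@_[::] = (nilp F)%:R.
Proof.
case: Psi_hopf => _ _ PsiE _; have := PsiE (basis F).
by rewrite /Csh_counit /HCK_counit mcoeffU1 forest_pi_eq_unit.
Qed.

Lemma Csh_cop_PsiF F :
  Csh_cop (PsiF F) = \sum_(p <- cuts F) tens (PsiF p.1) (PsiF p.2).
Proof.
case: Psi_hopf => _ _ _ Psicop.
by rewrite -(tens_map_HCK_cop (Psi : H -> W)); apply: Psicop.
Qed.

Lemma Csh_proj_PsiF1 t : Csh_proj (PsiF [:: t]) = phi << \pi_(tree D) t >>.
Proof.
rewrite -Psi_proj HCK_incl_basis /PsiF.
suff <- : \pi_(forest D) [:: t]
  = \pi_(forest D) [:: repr (\pi_(tree D) t)] by [].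
apply/forest_piP/forest_isoP; exists [:: repr (\pi_(tree D) t)] => //=.
by rewrite andbT; apply/(eqmodP (tree_iso_equiv D)); rewrite reprK.
Qed.

(** Nonempty forests have images without constant term, so multiplicativity propagates the values on
    trees to all forests. *)
Lemma Csh_proj_PsiF F : Csh_proj (PsiF F) = phi_ext F.
Proof.
elim: F => [|t F IH]; first by rewrite PsiF0 phi_ext0 Csh_proj1.
have [/nilP->|F0] := boolP (nilp F); first by rewrite Csh_proj_PsiF1 phi_ext1.
rewrite -cat1s PsiF_cat Csh_proj_qsh !mcoeff_PsiF_nil (negPf F0) !scale0r
  !add0r.
by rewrite phi_ext_cat // Csh_proj_PsiF1 IH phi_ext1.
Qed.

(** Applying [uncop] to the coproduct shows that [PsiF] satisfies the recursion defining [Phi]. *)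
Lemma PsiF_Phi F : PsiF F = Phi F.
Proof.
have [n] := ubnP (fsize F); elim: n F => // n IH F Fn.
rewrite [LHS]uncop_Csh_cop mcoeff_PsiF_nil Csh_cop_PsiF /uncop linear_sum
  PhiE_all.
apply: f_equal2.
  by rewrite /ceps; case: (nilp F); [exact: scale1r | exact: scale0r].
apply: eq_big_seq => p pF.
transitivity (uncop (tens (PsiF p.1) (PsiF p.2))); first by [].
rewrite uncop_tens Csh_proj_PsiF.
(* For empty [p.1] the induction hypothesis may not apply to [p.2], but both terms are 0. *)
have [/nilP->|p0] := boolP (nilp p.1); first by rewrite phi_ext0 !ccons0.
by rewrite IH //; apply: leq_trans (fsize_cut pF p0) _.
Qed.

Lemma Psi_uniq : Psi =1 Phi_linear.
Proof.
apply: (@eq_linear K (forest D) W).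
- exact: linearP.
- exact: linext_is_linear.
by apply: forest_pi_ind => F; rewrite Phi_linear_basis -PsiF_Phi.
Qed.

End Uniqueness.
End Morphism.

Theorem mainTheorem14 (K : fieldType) (charK : [pchar K] =i pred0)
    (D : choiceType) (hD : inhabited D)
    (op : D -> D -> D) (opA : associative op) (opC : commutative op)
    (phi : {linear {malg K[tree D]} -> {malg K[D]}}) :
  exists Phi : {linear HCK K D -> Csh K D},
    (hopf_morphism op Phi /\
      (forall x, Csh_proj (Phi (HCK_incl x)) = phi x)) /\
    (forall Psi : {linear HCK K D -> Csh K D},
      hopf_morphism op Psi ->
      (forall x, Csh_proj (Psi (HCK_incl x)) = phi x) ->
      Psi =1 Phi).
Proof.
exists (Phi_linear opA opC phi); split.
  split; [exact: Phi_hopf_morphism | exact: Csh_proj_Phi_linear].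
by move=> Psi Psi_hopf Psi_proj; apply: Psi_uniq.
Qed.
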